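(* Let $W$ be an affine Coxeter group (affine Weyl group) with affine root system $\Phi$ and positive roots $\Phi^+$, and let $W_0$ be the associated finite Coxeter group with finite root system $\Phi_0$. The biclosed subsets of $\Phi^+$ are in bijection with triples $(F,\Phi',w)$, where $F$ is a face of the Coxeter fan of $W_0$, $w\in W$ stabilizes $F$ (i.e. $w \in W_F$), and $\Phi'$ is a union of indecomposable components of $\Phi_F$ (the cases $\Phi'=\emptyset$ and $\Phi'=\Phi_F$ allowed). Explicitly, if $f$ is a functional in the relative interior of $F$, the biclosed set associated to the triple is \[ B(F,\Phi',w) = \Big( \big(\{\alpha+r\delta : r\in\mathbb{Z},\ \alpha\in\Phi_0,\ \langle f,\alpha\rangle>0\}\cap\Phi^+\big) \sqcup \Phi'_+ \Big) \oplus \big( N(w)\cap\Phi_F\big), \] where $\Phi'_+=\Phi'\cap\Phi^+$ and $\oplus$ denotes symmetric difference. Moreover, $B(F_1,\Phi'_1,w_1)$ and $B(F_2,\Phi'_2,w_2)$ lie in the same path component (i.e. have finite symmetric difference) if and only if $F_1=F_2$ and $\Phi'_1=\Phi'_2$.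
   Context: Setup: $\Phi_0$ is a finite, indecomposable, crystallographic (reduced) root system spanning a real vector space $V_0$ of dimension $n$, with simple roots $\alpha_1,\dots,\alpha_n$, positive roots $\Phi_0^+$, highest root $\theta$, and Weyl group $W_0$. Let $V=V_0\oplus\mathbb{R}\delta$. The affine root system is $\Phi=\{\alpha+k\delta:\alpha\in\Phi_0,\ k\in\mathbb{Z}\}$ with positive roots $\Phi^+=\Phi_0^+\cup\{\alpha+k\delta:\alpha\in\Phi_0,\ k\ge 1\}$ and simple roots $\alpha_1,\dots,\alpha_n,\alpha_0=\delta-\theta$; $W$ is the affine Weyl group generated by the reflections in these roots, acting linearly on $V$ and fixing $\delta$. For $w\in W$, its inversion set is $N(w)=\{\beta\in\Phi^+: w^{-1}\beta\in-\Phi^+\}$ (equivalently the roots $\beta_t$ of reflections $t$ with $\ell(tw)<\ell(w)$). A subset $B\subseteq\Phi^+$ is biclosed if for all $\alpha,\beta,\gamma\in\Phi^+$ with $\gamma\in\mathbb{R}_{>0}\alpha+\mathbb{R}_{>0}\beta$: if $\alpha,\beta\in B$ then $\gamma\in B$, and if $\alpha,\beta\notin B$ then $\gamma\notin B$. The Coxeter fan of $W_0$ lives in the dual space $V_0^\vee$; its maximal cones (chambers) are the $W_0$-translates of $\{f:\langle f,\alpha\rangle\ge0\ \forall \alpha\in\Phi_0^+\}$, and its faces are all intersections of chambers (including $\{0\}$). Identify $V_0^\vee$ with the functionals on $V$ vanishing on $\delta$; $W$ acts on this space (through its linear part $W\to W_0$), permuting faces. For a face $F$ with $f$ in its relative interior,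 $W_F$ is the stabilizer of $F$ in $W$ and $\Phi_F=\{\beta\in\Phi:\langle f,\beta\rangle=0\}$; $\Phi_F$ decomposes uniquely as a disjoint union of mutually orthogonal indecomposable root subsystems, its components.
   Formalization: For the bijection, W_F is the subgroup generated by the reflections of W that stabilize F, not the full stabilizer of F in W: that contains all translations, so for a chamber F (Φ_F empty) many w give the same B. The other claims are proved for the full stabilizer. *)

(* Defs.v *)
From HB Require Import structures.
From mathcomp Require Import all_boot all_order all_algebra sesquilinear.
From mathcomp Require Import boolp classical_sets functions cardinality reals.
Set Implicit Arguments.
Unset Strict Implicit.
Unset Printing Implicit Defensive.
Import Order.TTheory GRing.Theory Num.Theory.
Local Open Scope classical_set_scope.
Local Open Scope ring_scope.

(* The affine space V = V0 (+) R delta is represented by pairs: (v, r) stands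
   for v + r delta, so that delta = (0, 1). *)
Definition affV (R : realType) (V0 : vectType R) : vectType R := (V0 * R^o)%type.

Definition dualV (R : realType) (V0 : vectType R) : vectType R := 'Hom(V0, R^o).

Definition is_subgroup (R : realType) (U : vectType R) (G : set 'End(U)) :=
  [/\ G \1%VF, (forall g h, G g -> G h -> G (g \o h)%VF)
    & (forall g, G g -> G (g^-1)%VF)].

Definition generated (R : realType) (U : vectType R) (S : set 'End(U)) :
  set 'End(U) := smallest (@is_subgroup R U) S.

Definition indecomposable (R : realType) (T : Type) (dot : T -> T -> R)
    (X : set T) : Prop :=
  X !=set0 /\
  forall A B : set T, A `|` B = X -> A `&` B = set0 ->
    (forall a b, A a -> B b -> dot a b = 0) -> A = set0 \/ B = set0.

Section FiniteRootSystem.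
Variables (R : realType) (V0 : vectType R) (form : {dot V0 for idfun}).

Definition refl0 (a : V0) : 'End(V0) :=
  linfun (fun x : V0 => x - (2 * form x a / form a a) *: a).

Record is_root_system (Phi0 : set V0) : Prop := {
  root_finite : finite_set Phi0;
  root_neq0 : ~ Phi0 0;
  root_span : forall U : {vspace V0}, (forall a, Phi0 a -> a \in U) -> U = fullv;
  root_refl : forall a b, Phi0 a -> Phi0 b -> Phi0 (refl0 a b);
  root_int : forall a b, Phi0 a -> Phi0 b ->
    2 * form b a / form a a \in Num.int;
  root_reduced : forall (c : R) a, Phi0 a -> Phi0 (c *: a) -> c = 1 \/ c = -1
}.

Variable n : nat.

Definition nat_comb (simple : n.-tuple V0) (v : V0) : Prop :=
  exists c : 'I_n -> nat, v = \sum_(i < n) tnth simple i *+ c i.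

Definition is_simple_system (Phi0 : set V0) (simple : n.-tuple V0) : Prop :=
  [/\ basis_of {:V0} simple, (forall i, Phi0 (tnth simple i))
    & forall a, Phi0 a -> nat_comb simple a \/ nat_comb simple (- a)].

Definition is_highest_root (Phi0 : set V0) (simple : n.-tuple V0) (theta : V0) :
    Prop :=
  Phi0 theta /\ forall a, Phi0 a -> nat_comb simple (theta - a).

Definition pos_root0 (Phi0 : set V0) (simple : n.-tuple V0) : set V0 :=
  Phi0 `&` nat_comb simple.

Definition W0 (simple : n.-tuple V0) : set 'End(V0) :=
  generated [set g | exists i, g = refl0 (tnth simple i)].

Definition dominant (Phi0 : set V0) (simple : n.-tuple V0) : set (dualV V0) :=
  [set f | forall a, pos_root0 Phi0 simple a -> 0 <= f a].

Definition chamber (Phi0 : set V0) (simple : n.-tuple V0) :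
    set (set (dualV V0)) :=
  [set C | exists2 g, W0 simple g &
           C = [set (f \o g^-1)%VF | f in dominant Phi0 simple]].

(* The empty intersection is excluded: it would be the whole dual space. *)
Definition face (Phi0 : set V0) (simple : n.-tuple V0) : set (set (dualV V0)) :=
  [set F | exists Cs : set (set (dualV V0)),
           [/\ Cs !=set0, Cs `<=` chamber Phi0 simple & F = \bigcap_(C in Cs) C]].

Definition affine_hull (U : vectType R) (A : set U) : set U :=
  [set v | exists (m : nat) (c : 'I_m -> R) (u : 'I_m -> U),
    [/\ (forall i, A (u i)), \sum_(i < m) c i = 1
      & v = \sum_(i < m) c i *: u i]].

(* The interior of A in its affine hull, for the norm max_i |f(alpha_i)| of the
   dual space (all norms define the same topology in finite dimension). *)
Definition relint (simple : n.-tuple V0) (A : set (dualV V0)) :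
    set (dualV V0) :=
  [set f | A f /\ exists2 e : R, 0 < e &
    forall g, affine_hull A g ->
      (forall i, `|g (tnth simple i) - f (tnth simple i)| < e) -> A g].

End FiniteRootSystem.

Section AffineRootSystem.
Variables (R : realType) (V0 : vectType R) (form : {dot V0 for idfun}) (n : nat).

(* The form of V0 extended to V with delta in its radical. *)
Definition affform (x y : affV V0) : R := form x.1 y.1.

Definition refl (b : affV V0) : 'End(affV V0) :=
  linfun (fun v : affV V0 => v - (2 * affform v b / affform b b) *: b).

Definition Phi (Phi0 : set V0) : set (affV V0) :=
  [set b | exists a (k : int), Phi0 a /\ b = (a, k%:~R)].

Definition Phi_pos (Phi0 : set V0) (simple : n.-tuple V0) : set (affV V0) :=
  [set b | exists2 a, pos_root0 Phi0 simple a & b = (a, 0)] `|`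
  [set b | exists a (k : int), [/\ Phi0 a, 1 <= k & b = (a, k%:~R)]].

(* The last generator is the reflection in alpha_0 = delta - theta. *)
Definition W (simple : n.-tuple V0) (theta : V0) : set 'End(affV V0) :=
  generated ([set g | exists i, g = refl (tnth simple i, 0)] `|`
             [set refl (- theta, 1)]).

Definition N (Phi0 : set V0) (simple : n.-tuple V0) (w : 'End(affV V0)) :
    set (affV V0) :=
  [set b | Phi_pos Phi0 simple b /\ Phi_pos Phi0 simple (- (w^-1)%VF b)].

Definition biclosed (Phi0 : set V0) (simple : n.-tuple V0) (B : set (affV V0)) :
    Prop :=
  B `<=` Phi_pos Phi0 simple /\
  forall a b c, Phi_pos Phi0 simple a -> Phi_pos Phi0 simple b ->
    Phi_pos Phi0 simple c ->
    (exists s t : R, [/\ 0 < s, 0 < t & c = s *: a + t *: b]) ->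
    (B a -> B b -> B c) /\ (~ B a -> ~ B b -> ~ B c).

(* Identifies a functional on V0 with a functional on V vanishing on delta. *)
Definition ext (f : dualV V0) : 'Hom(affV V0, R^o) :=
  linfun (fun v : affV V0 => f v.1).

Definition stab (simple : n.-tuple V0) (theta : V0) (F : set (dualV V0)) :
    set 'End(affV V0) :=
  [set w | W simple theta w /\
           [set (h \o w^-1)%VF | h in ext @` F] = ext @` F].

(* W_F is the stabilizer of F as a reflection group, i.e. the subgroup
   generated by the reflections of W that stabilize F: the Weyl group of Phi_F.
   The full stabilizer [stab] moreover contains every translation of W, as
   translations act trivially on the functionals vanishing on delta. *)
Definition W_ (Phi0 : set V0) (simple : n.-tuple V0) (theta : V0)
    (F : set (dualV V0)) : set 'End(affV V0) :=
  generated [set t | stab simple theta F t /\ exists2 b, Phi Phi0 b & t = refl b].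

Definition Phi_ (Phi0 : set V0) (f : dualV V0) : set (affV V0) :=
  [set b | Phi Phi0 b /\ ext f b = 0].

Definition component (X : set (affV V0)) : set (set (affV V0)) :=
  [set Y | [/\ Y `<=` X, indecomposable affform Y
             & forall y z, Y y -> (X `\` Y) z -> affform y z = 0]].

Definition union_of_components (X X' : set (affV V0)) : Prop :=
  exists2 Ys : set (set (affV V0)), Ys `<=` component X & X' = \bigcup_(Y in Ys) Y.

Definition Bset (Phi0 : set V0) (simple : n.-tuple V0) (f : dualV V0)
    (Phi' : set (affV V0)) (w : 'End(affV V0)) : set (affV V0) :=
  (([set b | Phi Phi0 b /\ 0 < ext f b] `&` Phi_pos Phi0 simple)
     `|` (Phi' `&` Phi_pos Phi0 simple))
  `+` (N Phi0 simple w `&` Phi_ Phi0 f).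

(* Triples (F, Phi', w) with w in G F, where pt F is the chosen functional in
   the relative interior of F. *)
Definition triples (Phi0 : set V0) (simple : n.-tuple V0)
    (pt : set (dualV V0) -> dualV V0)
    (G : set (dualV V0) -> set 'End(affV V0)) :
    set (set (dualV V0) * set (affV V0) * 'End(affV V0)) :=
  [set p | [/\ face form Phi0 simple p.1.1,
               union_of_components (Phi_ Phi0 (pt p.1.1)) p.1.2
             & G p.1.1 p.2]].

Definition Btriple (Phi0 : set V0) (simple : n.-tuple V0)
    (pt : set (dualV V0) -> dualV V0)
    (p : set (dualV V0) * set (affV V0) * 'End(affV V0)) : set (affV V0) :=
  Bset Phi0 simple (pt p.1.1) p.1.2 p.2.

End AffineRootSystem.

(* Main.v *)
Require Import Defs.
From HB Require Import structures.
From mathcomp Require Import all_boot all_order all_algebra sesquilinear.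
From mathcomp Require Import boolp classical_sets functions cardinality reals.
From mathcomp Require Import zify ring lra.
Import Order.TTheory GRing.Theory Num.Theory.
Local Open Scope classical_set_scope.
Local Open Scope ring_scope.
Set Implicit Arguments.
Unset Strict Implicit.
Unset Printing Implicit Defensive.

(* Replacing B by P = B u -(Phi+ \ B) turns biclosed sets into the closed subsets
   P of Phi that contain exactly one root of each pair {b, -b}; B(F, Phi', w)
   becomes {f > 0} u {b in Phi_F : w^-1 b > 0 iff b in Phi'}. For such a P and a
   in Phi0, the set K_a of all k with a + k delta in P is empty, Z, or a half-line,
   and {a : K_a nonempty} is parabolic, hence of the form {f >= 0}. Where f = 0,
   the roots a for which K_a is bounded below are orthogonal to those for which it
   is bounded above, which gives Phi'; what is left differs from the model with
   w = 1 on a finite set, and a reflection s_b of Phi_F in a wrong root b strictly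
   decreases the number of wrong roots. The set {a : k delta + a in B for large k}
   recovers the signs of f and Phi', and w is then unique because W_F acts freely
   on its sets of positive roots, by the exchange property. *)

(** * Groups generated by involutions *)

(** The obstacle is that [Phi_F] may be infinite and reducible and comes without a base: the simple
    roots of its positive part need not be simple in [Phi]. Coxeter arguments are therefore
    developed for any reflection-closed set of roots with a semidefinite form and an integral height
    for which every reflection has a finite inversion set; simple roots are produced there by an
    extremality argument. This serves three times: for [Phi0], for [Phi], where it shows that [W]
    contains all reflections, and for [Phi_F]. Uniqueness of [w] fails for the full stabilizer of a
    face: when [Phi_F] is empty, all translations give the same set. Hence the bijection uses the
    reflection subgroup, whereas biclosedness and the finiteness criterion only use [w] in [W] and
    hold for the full stabilizer. *)

Lemma inv_lfun_eq (R : realType) (U : vectType R) (f g : 'End(U)) :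
  cancel f g -> cancel g f -> (f^-1)%VF = g.
Proof.
move=> fK gK; have k0 : lker f == 0%VS by apply/lker0P/(can_inj fK).
apply/lfunP => x; apply: (can_inj fK); rewrite gK; exact: lker0_lfunVK.
Qed.

Lemma generated_subgroup (R : realType) (U : vectType R) (S : set 'End(U)) :
  is_subgroup (generated S).
Proof.
split=> [A [[]] // | g h Gg Gh A [sA SA] | g Gg A [sA SA]].
- by case: (sA) => _ AM _; apply: AM; [apply: Gg | apply: Gh].
- by case: (sA) => _ _; apply; apply: Gg.
Qed.

Lemma sub_generated (R : realType) (U : vectType R) (S : set 'End(U)) :
  S `<=` generated S.
Proof. by move=> s Ss A [_]; apply. Qed.

Lemma generated_sub (R : realType) (U : vectType R) (S T : set 'End(U)) :
  S `<=` generated T -> generated S `<=` generated T.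
Proof. by move=> ST g; apply; split => //; apply: generated_subgroup. Qed.

(** [generated] is an intersection of subgroups and gives no induction by itself. Inverses of words
    in involutions are again words, so words form a subgroup. *)
Inductive word (R : realType) (U : vectType R) (S : set 'End(U)) :
    'End(U) -> Prop :=
| word1 : word S \1%VF
| wordM s g : S s -> word S g -> word S (s \o g)%VF.

Section Words.
Variables (R : realType) (U : vectType R) (S : set 'End(U)).
Hypothesis involS : forall s x, S s -> s (s x) = x.

Lemma word_mul g h : word S g -> word S h -> word S (g \o h)%VF.
Proof.
move=> wg wh; elim: wg => [|s k Ss _ IH]; first by rewrite comp_lfun1l.
by rewrite -comp_lfunA; apply: wordM.
Qed.

Lemma word_inv g : word S g -> exists2 h, word S h & cancel g h /\ cancel h g.
Proof.
elim=> [|s k Ss _ [h wh [kh hk]]].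
  exists \1%VF; first exact: word1.
  by split=> x; rewrite !id_lfunE.
exists (h \o s)%VF; last by split=> x; rewrite !comp_lfunE ?hk ?involS ?kh.
apply: word_mul => //; rewrite -[s]comp_lfun1r; apply: wordM => //; exact: word1.
Qed.

Lemma generated_word g : generated S g -> word S g.
Proof.
apply; split; last first.
  by move=> s Ss; rewrite -[s]comp_lfun1r; apply: wordM => //; exact: word1.
split; [exact: word1 | exact: word_mul |].
by move=> k /word_inv[h wh [kh hk]]; rewrite (inv_lfun_eq kh hk).
Qed.

Lemma generated_inv g : generated S g -> cancel g (g^-1)%VF /\ cancel (g^-1)%VF g.
Proof.
by move=> /generated_word/word_inv[h _ [gh hg]]; rewrite (inv_lfun_eq gh hg).
Qed.

Lemma generated_ind (P : 'End(U) -> Prop) : P \1%VF ->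
  (forall s g, S s -> P g -> P (s \o g)%VF) -> forall g, generated S g -> P g.
Proof. by move=> P1 PM g /generated_word; elim=> // s h Ss _; apply: PM. Qed.

End Words.

Lemma finite_min (R : realType) (T : eqType) (A : set T) (f : T -> R) :
  finite_set A -> A !=set0 -> exists2 x, A x & forall y, A y -> f x <= f y.
Proof.
move=> /finite_seqP[s ->] [x0 /= x0s].
elim: s x0 x0s => // a s IH _ _.
have [-> | [x xs]] : s = [::] \/ exists x, x \in s.
- by case: s {IH} => [|b s]; [left | right; exists b; rewrite mem_head].
- by exists a => /= [|y]; rewrite ?mem_head ?inE // => /eqP->.
have [m /= ms mle] := IH x xs.
have [le|lt] := leP (f m) (f a).
- exists m => /= [|y]; first by rewrite inE ms orbT.
  by rewrite inE => /orP[/eqP->//|/mle].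
- exists a => /= [|y]; first by rewrite mem_head.
  rewrite inE => /orP[/eqP->//|/mle]; apply: le_trans; exact: ltW.
Qed.

(** * Closed halves and reflections *)

(* [halfset Psi Q] is the two-sided form of biclosedness: Q is closed and contains
   exactly one root from each pair of opposite roots, so that its intersection
   with a positive system is biclosed. *)
Definition halfset (R : realType) (U : vectType R) (Psi Q : set U) : Prop :=
  (forall x, Psi x -> (Q (- x) <-> ~ Q x)) /\
  (forall x y z (s t : R), Psi x -> Psi y -> Psi z -> Q x -> Q y ->
     0 < s -> 0 < t -> z = s *: x + t *: y -> Q z).

Lemma halfset_sub (R : realType) (U : vectType R) (Psi Psi' Q : set U) :
  Psi' `<=` Psi -> halfset Psi Q -> halfset Psi' Q.
Proof.
move=> sP [QN Qc]; split=> [x /sP|x y z s t /sP Px /sP Py /sP]; first exact: QN.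
exact: Qc.
Qed.

(** Lexicographic refinement: [f] decides first and [Q] breaks ties. If [f] vanishes on a positive
    combination of elements where it is nonnegative, the whole relation lies in its kernel. *)
Lemma halfset_lex (R : realType) (U : vectType R) (Psi Q : set U) (f : U -> R) :
  (forall x y, f (x + y) = f x + f y) -> (forall c x, f (c *: x) = c * f x) ->
  halfset (Psi `&` [set x | f x = 0]) Q ->
  halfset Psi [set x | 0 < f x \/ (f x = 0 /\ Q x)].
Proof.
move=> fD fZ [QN Qc].
have fN x : f (- x) = - f x by rewrite -scaleN1r fZ mulN1r.
split=> [x Px /=|x y z s t Px Py Pz /= Qx Qy s0 t0 zE].
  rewrite fN oppr_gt0; have [f0|f0|f0] := ltgtP (f x) 0.
  - by split=> [_ [//|[fx0]]|_]; [move: f0; rewrite fx0 ltxx|left].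
  - split=> [[//|[fx0]]|]; last by case; left.
    by move: f0; rewrite -[f x]opprK fx0 oppr0 ltxx.
  - have := QN x (conj Px f0); rewrite f0 oppr0 => -[h1 h2].
    split=> [[//|[_ /h1 nQ]] [//|[]//]|nQ]; right.
    by split=> //; apply: h2 => Qx; apply: nQ; right.
have fz : f z = s * f x + t * f y by rewrite zE fD !fZ.
have ge0 u : 0 < f u \/ (f u = 0 /\ Q u) -> 0 <= f u by case=> [/ltW//|[->]].
have [fx fy] := (ge0 _ Qx, ge0 _ Qy).
have [f0|f0] := leP (f z) 0; last by left.
have [sx ty] : 0 <= s * f x /\ 0 <= t * f y by rewrite !mulr_ge0 // ltW.
have fx0 : f x = 0 by apply: (mulfI (lt0r_neq0 s0)); rewrite mulr0; lra.
have fy0 : f y = 0 by apply: (mulfI (lt0r_neq0 t0)); rewrite mulr0; lra.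
have fz0 : f z = 0 by rewrite fz fx0 fy0 !mulr0 addr0.
right; split=> //; apply: (Qc x y z s t) => //.
- by case: Qx => [|[]//]; rewrite fx0 ltxx.
- by case: Qy => [|[]//]; rewrite fy0 ltxx.
Qed.

Section Functionals.
Variables (R : realType) (U : vectType R) (f : 'Hom(U, R^o)).

Lemma functionalD x y : f (x + y) = f x + f y :> R.
Proof. by rewrite linearD. Qed.

Lemma functionalZ c x : f (c *: x) = c * f x :> R.
Proof. by rewrite linearZ. Qed.

Lemma functionalN x : f (- x) = - f x :> R.
Proof. by rewrite linearN. Qed.

End Functionals.

(** [refl0] and [refl] are both convertible to instances of this, so each statement below serves
    [V0] and [V]. *)
Definition srefl (R : realType) (U : vectType R) (B : U -> U -> R) (b : U) :
    'End(U) :=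
  linfun (fun x : U => x - (2 * B x b / B b b) *: b).

(** Only semidefinite, because [delta] lies in the radical of the affine form. *)
Record semidot (R : realType) (U : vectType R) (B : U -> U -> R) : Prop := {
  sdotDl : forall x y z, B (x + y) z = B x z + B y z;
  sdotZl : forall c x y, B (c *: x) y = c * B x y;
  sdotC : forall x y, B x y = B y x;
  sdot_ge0 : forall x, 0 <= B x x
}.

Record refl_closed (R : realType) (U : vectType R) (B : U -> U -> R)
    (Psi : set U) : Prop := {
  rc_gt0 : forall b, Psi b -> 0 < B b b;
  rc_refl : forall b c, Psi b -> Psi c -> Psi (srefl B b c)
}.

Section Reflections.
Variables (R : realType) (U : vectType R) (B : U -> U -> R).
Hypothesis hB : semidot B.

Lemma sdotDr x y z : B x (y + z) = B x y + B x z.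
Proof. by rewrite sdotC // sdotDl // ![B _ x]sdotC. Qed.

Lemma sdotZr c x y : B x (c *: y) = c * B x y.
Proof. by rewrite sdotC // sdotZl // [B _ x]sdotC. Qed.

Lemma sdotNl x y : B (- x) y = - B x y.
Proof. by rewrite -scaleN1r sdotZl // mulN1r. Qed.

Lemma sdotNr x y : B x (- y) = - B x y.
Proof. by rewrite -scaleN1r sdotZr mulN1r. Qed.

Lemma sreflE b x : srefl B b x = x - (2 * B x b / B b b) *: b.
Proof.
pose f x : U := x - (2 * B x b / B b b) *: b.
have lf : linear f.
  move=> c u v; rewrite /f sdotDl // sdotZl // scalerBr addrACA -opprD scalerA.
  by rewrite -scalerDl; congr (_ - _ *: _); ring.
pose g : {linear U -> U} := HB.pack f (GRing.isLinear.Build R U U _ f lf).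
exact: (lfunE g).
Qed.

Lemma srefl_id b : 0 < B b b -> srefl B b b = - b.
Proof.
move=> b0; rewrite sreflE mulfK ?gt_eqF //.
by rewrite -{1}[b]scale1r -scalerBl -scaleN1r; congr (_ *: _); ring.
Qed.

Lemma sreflK b x : 0 < B b b -> srefl B b (srefl B b x) = x.
Proof.
move=> b0; rewrite sreflE [B _ b]sdotC // [srefl B b x]sreflE sdotDr sdotNr sdotZr.
rewrite -addrA -opprD -scalerDl [B x b]sdotC // -[RHS]subr0; congr (_ - _).
rewrite -[RHS](scale0r b); congr (_ *: _); field; exact: lt0r_neq0.
Qed.

Lemma srefl_isom b x y : 0 < B b b -> B (srefl B b x) (srefl B b y) = B x y.
Proof.
move=> b0; rewrite !sreflE sdotDl // !sdotDr !sdotNl !sdotNr !sdotZl // !sdotZr.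
rewrite [B b y]sdotC //; field; exact: lt0r_neq0.
Qed.

Lemma srefl_fix b x : B x b = 0 -> srefl B b x = x.
Proof. by move=> h; rewrite sreflE h mulr0 mul0r scale0r subr0. Qed.

Lemma srefl_conj (g : 'End(U)) b : (forall x y, B (g x) (g y) = B x y) ->
  (g \o srefl B b = srefl B (g b) \o g)%VF.
Proof.
by move=> gB; apply/lfunP => x; rewrite !comp_lfunE !sreflE linearB linearZ !gB.
Qed.

Lemma sreflN b : srefl B (- b) = srefl B b.
Proof.
by apply/lfunP => x; rewrite !sreflE !sdotNr sdotNl opprK mulrN mulNr scaleNr scalerN opprK.
Qed.

Lemma refl_closedN Psi b : refl_closed B Psi -> Psi b -> Psi (- b).
Proof. by move=> rc Pb; rewrite -srefl_id ?(rc_gt0 rc) //; apply: rc_refl. Qed.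

Section Transitivity.
Variable Psi : set U.
Hypothesis hPsi : refl_closed B Psi.

Let PsiN b : Psi b -> Psi (- b). Proof. exact: refl_closedN. Qed.

Lemma half_srefl Q b : Psi b -> halfset Psi Q -> halfset Psi [set x | Q (srefl B b x)].
Proof.
move=> Pb [QN Qc]; split=> [x Px /=|x y z s t Px Py Pz /= Qx Qy s0 t0 zE].
  by rewrite linearN; apply: QN; apply: (rc_refl hPsi).
apply: (Qc (srefl B b x) (srefl B b y) _ s t) => //; try exact: (rc_refl hPsi).
by rewrite zE linearD !linearZ.
Qed.

(* If [Q0 c] and [~ Q (s_b c)], then [c' := if Q0 (s_b c) then s_b c else c] lies
   in [Q0] and not in [Q], and [c] is recovered from [c'] by the same recipe;
   moreover [c' <> b]. *)
Lemma half_srefl_sub Q0 Q b (r : seq U) : halfset Psi Q0 -> halfset Psi Q ->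
  Psi b -> Q0 b -> ~ Q b ->
  (forall x, Psi x -> Q0 x -> ~ Q x -> x \in r) ->
  exists2 r' : seq U, (size r' < size r)%N &
    forall x, Psi x -> Q0 x -> ~ Q (srefl B b x) -> x \in r'.
Proof.
move=> [Q0N Q0c] [QN Qc] Pb Q0b nQb sub.
have b0 := rc_gt0 hPsi Pb.
pose s := srefl B b; have sK x : s (s x) = x by apply: sreflK.
have Ps x : Psi x -> Psi (s x) by apply: (rc_refl hPsi).
exists [seq if `[< Q0 (s y) >] then s y else y | y <- r & y != b].
  rewrite size_map size_filter -(count_predC (pred1 b) r) -[X in (X < _)%N]add0n.
  by rewrite ltn_add2r -has_count; apply/hasP; exists b => /=; [apply: sub | apply/eqP].
move=> x Px Q0x nQsx; apply/mapP.
have [Q0s|nQ0s] := pselect (Q0 (s x)).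
  exists (s x); last by rewrite sK asboolT.
  rewrite mem_filter sub ?andbT //; last exact: Ps.
  apply/eqP => sxb; move: Q0x; rewrite -[x]sK sxb /s srefl_id // => /Q0N; exact.
exists x; last by rewrite asboolF.
(* Here [x] and [s x] are on opposite sides of [Q0]. Closedness of [Q0] forces [m > 0]; then
   closedness of [Q] puts [- x = - s x + m (- b)] into [Q]. *)
have nQ0N : Q0 (- s x) by apply/Q0N => //; apply: Ps.
have QNsx : Q (- s x) by apply/QN => //; apply: Ps.
have QNb : Q (- b) by apply/QN.
have sxE : s x = x - (2 * B x b / B b b) *: b by rewrite /s sreflE.
set m := 2 * B x b / B b b in sxE.
have m0 : 0 < m.
  rewrite ltNge; apply/negP => m0; apply: nQ0s.
  have [m00|m00] := eqVneq m 0; first by rewrite sxE m00 scale0r subr0.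
  apply: (Q0c x b _ 1 (- m)) => //; [exact: Ps | by rewrite oppr_gt0 lt_neqAle m00 |].
  by rewrite sxE scale1r scaleNr.
rewrite mem_filter; apply/andP; split.
  by apply/eqP => xb; apply: nQsx; rewrite -/s xb /s srefl_id.
apply: sub => // Qx; have /QN : Q (- x); last by apply.
apply: (Qc (- s x) (- b) _ 1 m) => //; try by apply: PsiN => //; apply: Ps.
by rewrite sxE scale1r scalerN opprB addrAC addrN add0r.
Qed.

(** Only the roots in [Q0] outside [Q] need counting: both halves choose one of [x] and [- x], so an
    inclusion between them is an equality. *)
Lemma half_transitive Q0 Q : halfset Psi Q0 -> halfset Psi Q ->
  finite_set [set x | [/\ Psi x, Q0 x & ~ Q x]] ->
  exists2 g, generated [set srefl B b | b in Psi] g &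
    forall x, Psi x -> (Q x <-> Q0 (g x)).
Proof.
move=> hQ0 hQ /finite_seqP[r rE].
have: forall x, Psi x -> Q0 x -> ~ Q x -> x \in r.
  by move=> x Px Q0x nQx; suff: [set` r] x by []; rewrite -rE.
have [k rk] : exists k, (size r <= k)%N by exists (size r).
elim: k r Q hQ rk {rE} => [|k IH] r Q hQ rk sub; last first.
  have [[b [Pb Q0b nQb]]|none] :=
      pselect (exists b, [/\ Psi b, Q0 b & ~ Q b]); last first.
    apply: (IH [::]) => // x Px Q0x nQx; exfalso; apply: none; by exists x.
  have [r' sz sub'] := half_srefl_sub hQ0 hQ Pb Q0b nQb sub.
  have [|g Gg gE] := IH r' _ (half_srefl Pb hQ) _ sub'.
    by rewrite -ltnS (leq_trans sz).
  have [_ GM _] := generated_subgroup [set srefl B b | b in Psi].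
  exists (g \o srefl B b)%VF.
    by apply: GM => //; apply: sub_generated; exists b.
  move=> x Px; rewrite comp_lfunE -gE /= ?sreflK //; last exact: (rc_refl hPsi).
  exact: (rc_gt0 hPsi).
exists \1%VF; first by case: (generated_subgroup [set srefl B b | b in Psi]).
have {}sub x : Psi x -> Q0 x -> Q x.
  move=> Px Q0x; apply: contrapT => /(sub x Px Q0x).
  by move: rk; rewrite leqn0 size_eq0 => /eqP->.
move=> x Px; rewrite id_lfunE; split; last exact: sub.
move=> Qx; apply: contrapT => /(hQ0.1 x Px) /(sub _ (PsiN Px)).
by move=> /(hQ.1 x Px); apply.
Qed.

End Transitivity.
End Reflections.

(** * Simple roots *)

Lemma int_num_ge1 (R : realType) (x : R) : x \in Num.int -> 0 < x -> 1 <= x.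
Proof. by move=> /intrP[k ->]; rewrite ltr0z ler1z; lia. Qed.

Section SimpleRoots.
Variables (R : realType) (U : vectType R) (B : U -> U -> R).
Hypothesis hB : semidot B.
Variables (Psi : set U) (ell : U -> R).
Hypothesis hPsi : refl_closed B Psi.

Definition pos : set U := [set b | Psi b /\ 0 < ell b].

(** Simple roots are described through their reflections, since no base of [Phi_F] is given. *)
Definition is_simple (b : U) : Prop :=
  pos b /\ forall c, pos c -> c <> b -> 0 < ell (srefl B b c).

(** Finiteness of inversion sets ([hf_fin]) stands in for finiteness of [Psi], [hf_int] permits
    induction on the height, and [hf_sep] makes up for the radical of [B], whose nonzero vectors are
    detected by [ell]. *)
Record height_fun : Prop := {
  hfD : forall x y, ell (x + y) = ell x + ell y;
  hfZ : forall c x, ell (c *: x) = c * ell x;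
  hf_int : forall b, Psi b -> ell b \in Num.int;
  hf_neq0 : forall b, Psi b -> ell b != 0;
  hf_reduced : forall b c, Psi b -> 0 < c -> Psi (c *: b) -> c = 1;
  hf_fin : forall b, Psi b -> finite_set [set c | pos c /\ ell (srefl B b c) < 0];
  hf_sep : forall x, B x x = 0 -> ell x = 0 -> x = 0
}.
Hypothesis hell : height_fun.

Lemma hfN x : ell (- x) = - ell x.
Proof. by rewrite -scaleN1r hfZ // mulN1r. Qed.

Lemma half_pos : halfset Psi pos.
Proof.
split=> [x Px|x y z s t Px Py Pz [_ x0] [_ y0] s0 t0 zE].
  have := hf_neq0 hell Px; rewrite neq_lt => /orP[x0|x0]; split.
  - by move=> _ [_]; rewrite ltNge ltW.
  - by move=> _; split; [apply: (refl_closedN hB hPsi)|rewrite hfN oppr_gt0].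
  - by move=> [_]; rewrite hfN oppr_gt0 ltNge ltW.
  - by case; split.
by split=> //; rewrite zE hfD // !hfZ // addr_gt0 // mulr_gt0.
Qed.

Lemma nonpos_ell b : Psi b -> ~ 0 < ell b -> ell b < 0.
Proof.
by move=> Pb /negP; rewrite -leNgt le_eqVlt (negPf (hf_neq0 hell Pb)).
Qed.

(* Among the positive roots c sent to a negative root by s_b, normalised so as
   to have height 1, take first those on which ell o s_b is minimal and then one
   of maximal norm: it spans an extreme ray of the cone of positive roots. *)
Lemma exists_simple b : pos b ->
  exists2 c, is_simple c & ell (srefl B b c) < 0.
Proof.
move=> [Pb ellb]; pose nu x := ell (srefl B b x).
have nuD x y : nu (x + y) = nu x + nu y by rewrite /nu linearD hfD.
have nuZ c x : nu (c *: x) = c * nu x by rewrite /nu linearZ hfZ.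
pose M := [set c | pos c /\ nu c < 0].
have M0 : M !=set0.
  by exists b; split; [split | rewrite /nu srefl_id ?(rc_gt0 hPsi) // hfN oppr_lt0].
have fM : finite_set M := hf_fin hell Pb.
have [m0 Mm0 r0min] := finite_min (fun c => nu c / ell c) fM M0.
set r0 := nu m0 / ell m0 in r0min.
have r0lt : r0 < 0 by case: Mm0 => -[_ e0] n0; rewrite /r0 pmulr_llt0 // invr_gt0.
have nuge c : pos c -> r0 * ell c <= nu c.
  move=> pc; have [c0|c0] := leP 0 (nu c).
    by apply: le_trans c0; rewrite nmulr_rle0 // ltW //; case: pc.
  by rewrite -ler_pdivlMr; [apply: r0min | case: pc].
pose T := [set c | M c /\ nu c = r0 * ell c].
have fT : finite_set T by apply: sub_finite_set fM => c [].
have T0 : T !=set0.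
  by exists m0; split=> //; rewrite /r0 divfK // gt_eqF //; case: Mm0 => -[].
have [m [Mm nuE] qmax] := finite_min (fun c => - (B c c / ell c ^+ 2)) fT T0.
have [pm num] := Mm; have [Pm em] := pm; exists m => //; split=> // c pc cm.
apply: contrapT => nec; have [Pc ec] := pc.
have Psc : Psi (srefl B m c) by apply: (rc_refl hPsi).
(* If [s_m c] is negative, then [c] and [d] are positive roots whose sum is a multiple of [m].
   Minimality of [r0] then puts both of them in [T]. *)
pose d := - srefl B m c.
have pd : pos d.
  by split; [apply: (refl_closedN hB hPsi) | rewrite /d hfN oppr_gt0; apply: nonpos_ell].
have [_ ed] := pd.
pose k := 2 * B c m / B m m; have cd : c + d = k *: m.
  by rewrite /d sreflE // opprB addrC subrK.
clearbody d.
have hk : k * ell m = ell c + ell d by rewrite -hfZ // -cd hfD.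
have nucd : nu c + nu d = r0 * (ell c + ell d).
  by rewrite -nuD cd nuZ nuE -hk; ring.
have [nc nd] := (nuge _ pc, nuge _ pd).
have Tin x : pos x -> nu x = r0 * ell x -> T x.
  by move=> px xE; do !split=> //; [case: px..|rewrite xE nmulr_rlt0 //; case: px].
have Tc : T c by apply: Tin => //; lra.
have Td : T d by apply: Tin => //; lra.
set q := B m m / ell m ^+ 2 in qmax.
have qle x : T x -> B x x <= q * ell x ^+ 2.
  move=> Tx; rewrite -ler_pdivrMr ?exprn_gt0 //; first by have := qmax x Tx; rewrite lerN2.
  by case: Tx => -[[]].
have [qc qd] := (qle _ Tc, qle _ Td).
have BE : B c c + 2 * B c d + B d d = q * (ell c + ell d) ^+ 2.
  have -> : B c c + 2 * B c d + B d d = B (c + d) (c + d).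
    by rewrite sdotDl // !sdotDr // [B d c]sdotC //; ring.
  rewrite cd sdotZl // sdotZr // -hk /q exprMn; field; exact: lt0r_neq0.
(* [c / ell c] and [d / ell d] have norm at most [q], but a convex combination of them, [m / ell m],
   has norm exactly [q]. By strict convexity modulo the radical they agree there, and [hf_sep] makes
   them equal. *)
pose x := ell d *: c - ell c *: d.
have Bx : B x x = ell d ^+ 2 * B c c - 2 * ell c * ell d * B c d + ell c ^+ 2 * B d d.
  rewrite /x sdotDl // !sdotDr // !sdotNl // !sdotNr // !sdotZl // !sdotZr //.
  by rewrite [B d c]sdotC //; ring.
have x0 : x = 0.
  apply: (hf_sep hell); last by rewrite /x hfD // hfN !hfZ //; ring.
  apply/eqP; rewrite eq_le sdot_ge0 // andbT Bx.
  have h1 : 2 * B c d >= 2 * q * ell c * ell d.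
    have -> : 2 * B c d = q * (ell c + ell d) ^+ 2 - B c c - B d d by rewrite -BE; ring.
    by nra.
  have : ell d ^+ 2 * B c c <= ell d ^+ 2 * (q * ell c ^+ 2).
    by rewrite ler_pM2l // exprn_gt0.
  have : ell c ^+ 2 * B d d <= ell c ^+ 2 * (q * ell d ^+ 2).
    by rewrite ler_pM2l // exprn_gt0.
  have : ell c * ell d * (2 * q * ell c * ell d) <= ell c * ell d * (2 * B c d).
    by rewrite ler_pM2l // mulr_gt0.
  lra.
have cE : c = (ell c * k / (ell c + ell d)) *: m.
  have s0 : ell c + ell d != 0 by rewrite gt_eqF // addr_gt0.
  apply: (scalerI s0); rewrite scalerA mulrC divfK // -scalerA -cd scalerDr scalerDl.
  by congr (_ + _); apply/eqP; rewrite -subr_eq0 -/x x0.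
apply: cm; rewrite cE (hf_reduced hell Pm _ (c := _ / _)) ?scale1r -?cE //.
rewrite divr_gt0 ?addr_gt0 // mulr_gt0 // -(pmulr_lgt0 _ em) hk addr_gt0 //.
Qed.

(** Induction on the height: a simple [s] that [s_c] makes negative has [B s c > 0]. If [s] differs
    from [c], then [s_s c] is positive of smaller height and [s_c] is conjugate by [s_s] to its
    reflection. *)
Lemma simple_generate b : Psi b ->
  generated [set srefl B c | c in is_simple] (srefl B b).
Proof.
have pos_gen k c : pos c -> ell c < k%:R ->
    generated [set srefl B c | c in is_simple] (srefl B c).
  elim: k c => [|k IH] c pc ck; first by case: pc => _; rewrite ltNge ltW.
  have [s simp neg] := exists_simple pc.
  have [ps sperm] := simp.
  have [Gs GM GV] := generated_subgroup [set srefl B c | c in is_simple].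
  have Gsr : generated [set srefl B c | c in is_simple] (srefl B s).
    by apply: sub_generated; exists s.
  have [->//|cs] := pselect (c = s).
  have [Ps es] := ps; have [Pc ec] := pc.
  have b0 := rc_gt0 hPsi Ps; have c0 := rc_gt0 hPsi Pc.
  have Bsc : 0 < B s c.
    move: neg; rewrite sreflE // hfD // hfN hfZ //.
    have [//|le0] := ltP 0 (B s c).
    suff : 2 * B s c / B c c * ell c <= 0 by lra.
    by rewrite pmulr_lle0 // pmulr_lle0 ?invr_gt0 // pmulr_rle0.
  have ltc : ell (srefl B s c) < ell c.
    rewrite sreflE // hfD // hfN hfZ // ltrBlDr ltrDl mulr_gt0 //.
    by rewrite divr_gt0 // mulr_gt0 // sdotC.
  have psc : pos (srefl B s c).
    by split; [apply: (rc_refl hPsi) | apply: sperm].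
  have -> : srefl B c = (srefl B s \o (srefl B (srefl B s c) \o srefl B s))%VF.
    rewrite -srefl_conj => [|//|x y]; last exact: srefl_isom.
    by apply/lfunP => x; rewrite !comp_lfunE sreflK.
  apply: (GM) => //; apply: (GM) => //; apply: IH => //.
  have /intrP[i iE] := hf_int hell Pc.
  have /intrP[j jE] := hf_int hell psc.1.
  move: ltc ck; rewrite iE jE (pmulrn _ k) (pmulrn _ k.+1) !ltr_int; lia.
move=> Pb; have [eb|/(nonpos_ell Pb) eb] := pselect (0 < ell b).
  by apply: (pos_gen (Num.trunc (ell b)).+1) => //; apply: truncnS_gt.
rewrite -sreflN //; apply: (pos_gen (Num.trunc (ell (- b))).+1); last exact: truncnS_gt.
by split; [apply: (refl_closedN hB hPsi) | rewrite hfN oppr_gt0].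
Qed.

Definition refl_prod (bs : seq U) : 'End(U) :=
  foldr (fun b g => (srefl B b \o g)%VF) \1%VF bs.

Lemma refl_prod_rcons bs b :
  refl_prod (rcons bs b) = (refl_prod bs \o srefl B b)%VF.
Proof.
elim: bs => [|c bs IH] /=; first by rewrite comp_lfun1l comp_lfun1r.
by rewrite IH comp_lfunA.
Qed.

Lemma refl_prod_Psi bs x : (forall c, c \in bs -> is_simple c) -> Psi x ->
  Psi (refl_prod bs x).
Proof.
elim: bs => [|c bs IH] /= sbs Px; first by rewrite id_lfunE.
rewrite comp_lfunE; apply: (rc_refl hPsi).
  by have [[]] := sbs c (mem_head _ _).
by apply: IH => // d dbs; apply: sbs; rewrite inE dbs orbT.
Qed.

Lemma refl_prod_isom bs x y : (forall c, c \in bs -> is_simple c) ->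
  B (refl_prod bs x) (refl_prod bs y) = B x y.
Proof.
elim: bs => [|c bs IH] /= sbs; first by rewrite !id_lfunE.
rewrite !comp_lfunE srefl_isom ?IH //; last first.
  by have [[Pc _] _] := sbs c (mem_head _ _); apply: (rc_gt0 hPsi).
by move=> d dbs; apply: sbs; rewrite inE dbs orbT.
Qed.

(** Reading the word from the right, some letter [c] first makes the image of [b] negative. That
    image must be [c], since [s_c] keeps every other positive root positive; conjugation then
    deletes the letter. *)
Lemma simple_exchange bs b : (forall c, c \in bs -> is_simple c) -> pos b ->
  ell (refl_prod bs b) < 0 ->
  exists cs, [/\ size bs = (size cs).+1, (forall c, c \in cs -> is_simple c)
    & (refl_prod bs \o srefl B b)%VF = refl_prod cs].
Proof.
move=> + pb; elim: bs => [|c bs IH] sbs.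
  by rewrite id_lfunE; case: pb => _ /ltW; rewrite leNgt => /negbTE->.
have sbs' d : d \in bs -> is_simple d by move=> dbs; apply: sbs; rewrite inE dbs orbT.
have [pc cperm] := sbs c (mem_head _ _).
have Px : Psi (refl_prod bs b) by apply: refl_prod_Psi => //; case: pb.
have [neg _|/negP] := boolP (ell (refl_prod bs b) < 0).
  have [cs [sz scs csE]] := IH sbs' neg.
  exists (c :: cs); split=> /= [|d|]; first by rewrite sz.
    by rewrite inE => /orP[/eqP->|/scs//]; apply: sbs; rewrite mem_head.
  by rewrite -csE comp_lfunA.
move=> /negP; rewrite -leNgt le_eqVlt eq_sym (negPf (hf_neq0 hell Px)) /= => ex.
rewrite comp_lfunE => neg; exists bs; split=> //=.
have bc : refl_prod bs b = c.
  apply: contrapT => bc; have := cperm _ (conj Px ex) bc.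
  by rewrite ltNge ltW.
rewrite -comp_lfunA srefl_conj // => [|x y]; last exact: refl_prod_isom.
apply/lfunP => x; rewrite !comp_lfunE bc sreflK //.
by apply: (rc_gt0 hPsi); case: pc.
Qed.

(** The last letter [b] of a word for [g] is made negative by the rest of the word, because [g b] is
    positive. The exchange property therefore shortens the word by two. *)
Lemma simple_free g : generated [set srefl B c | c in Psi] g ->
  (forall x, pos x -> 0 < ell (g x)) -> g = \1%VF.
Proof.
move=> Gg gpos.
have {Gg} : generated [set srefl B c | c in is_simple] g.
  apply: generated_sub Gg => _ [b Pb <-]; exact: simple_generate.
have inv s x : [set srefl B c | c in is_simple] s -> s (s x) = x.
  by move=> [c [[Pc _] _] <-]; apply: sreflK => //; apply: (rc_gt0 hPsi).
move=> /(generated_word inv) wg.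
have [bs sbs gE] : exists2 bs, (forall c, c \in bs -> is_simple c) & g = refl_prod bs.
  elim: wg => [|_ h [c sc <-] _ [bs sbs ->]]; first by exists [::].
  by exists (c :: bs) => // d; rewrite inE => /orP[/eqP->|/sbs].
rewrite gE in gpos *; move: gpos sbs {gE}.
have [k] := ubnP (size bs); elim: k bs => // k IH bs.
case/lastP: bs => [//|bs b]; rewrite size_rcons ltnS => bk gpos sbs.
have sb : is_simple b by apply: sbs; rewrite mem_rcons mem_head.
have sbs' c : c \in bs -> is_simple c.
  by move=> cbs; apply: sbs; rewrite mem_rcons inE cbs orbT.
have neg : ell (refl_prod bs b) < 0.
  have := gpos b sb.1; rewrite refl_prod_rcons comp_lfunE srefl_id //.
    by rewrite linearN hfN oppr_gt0.
  by apply: (rc_gt0 hPsi); case: sb => -[].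
have [cs [sz scs csE]] := simple_exchange sbs' sb.1 neg.
rewrite refl_prod_rcons csE; apply: IH => //.
  by apply: leq_trans bk; rewrite sz.
by move=> x px; rewrite -csE -refl_prod_rcons; apply: gpos.
Qed.

(** For [b] simple and [a] in [Delta] with [B b a > 0], the height of [s_b a] is 1 minus a product
    of two integers that are at least 1, which is not positive; so [a = b]. *)
Lemma is_simple_sub (Delta : set U) :
  (forall a, Delta a -> Psi a /\ ell a = 1) ->
  (forall b c, Psi b -> Psi c -> 2 * B c b / B b b \in Num.int) ->
  (forall b, pos b -> exists2 a, Delta a & 0 < B b a) ->
  is_simple `<=` Delta.
Proof.
move=> hD cryst hpos b [pb bperm]; have [a Da Bba] := hpos b pb.
have [Pa ea] := hD a Da; have [Pb eb] := pb.
have [<-//|ab] := pselect (a = b).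
have := bperm a (conj Pa _) ab; rewrite ea => /(_ ltr01).
rewrite sreflE // hfD // hfN hfZ // ea.
have b0 := rc_gt0 hPsi Pb.
have : 1 <= 2 * B a b / B b b.
  apply: int_num_ge1; first exact: cryst.
  by rewrite divr_gt0 // mulr_gt0 // sdotC.
have := int_num_ge1 (hf_int hell Pb) eb; nra.
Qed.

Lemma generated_refl (Delta : set U) :
  (forall a, Delta a -> Psi a /\ ell a = 1) ->
  (forall b c, Psi b -> Psi c -> 2 * B c b / B b b \in Num.int) ->
  (forall b, pos b -> exists2 a, Delta a & 0 < B b a) ->
  forall b, Psi b -> generated [set srefl B a | a in Delta] (srefl B b).
Proof.
move=> hD cryst hpos b Pb; apply: generated_sub (simple_generate Pb) => _ [c sc <-].
apply: sub_generated; exists c => //; exact: (is_simple_sub hD).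
Qed.

End SimpleRoots.

(** * Affine root systems *)

Section FiniteSystem.
Variables (R : realType) (V0 : vectType R) (form : {dot V0 for idfun}).

Lemma form_semidot : semidot (form : V0 -> V0 -> R).
Proof.
split=> [x y z|c x y|x y|x].
- by rewrite linearDl.
- by rewrite linearZl_LR.
- by rewrite hermC expr0 mul1r.
- have [->|x0] := eqVneq x 0; first by rewrite linear0l.
  exact/ltW/neq0_dnorm_gt0.
Qed.

Lemma affform_semidot : semidot (affform form).
Proof.
have [hD hZ hC h0] := form_semidot.
by split=> [x y z|c x y|x y|x]; [exact: hD|exact: hZ|exact: hC|exact: h0].
Qed.

Lemma form_eq0 x : form x x = 0 -> x = 0.
Proof.
move=> x0; apply/eqP/negPn/negP => /(neq0_dnorm_gt0 (s := form)).
by rewrite x0 ltxx.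
Qed.

Variables (n : nat) (Phi0 : set V0) (simple : n.-tuple V0) (theta : V0).
Hypothesis hPhi0 : is_root_system form Phi0.
Hypothesis hsimple : is_simple_system Phi0 simple.
Hypothesis htheta : is_highest_root Phi0 simple theta.

Lemma root_gt0 a : Phi0 a -> 0 < form a a.
Proof.
move=> Pa; apply: neq0_dnorm_gt0; apply/eqP => a0.
by apply: (root_neq0 hPhi0); rewrite -a0.
Qed.

Lemma root_refl_closed : refl_closed form Phi0.
Proof. split; [exact: root_gt0 | exact: (root_refl hPhi0)]. Qed.

Lemma rootN a : Phi0 a -> Phi0 (- a).
Proof. exact: (refl_closedN form_semidot root_refl_closed). Qed.

Definition ht (v : V0) : R := \sum_(i < n) coord simple i v.

Lemma htD x y : ht (x + y) = ht x + ht y.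
Proof. by rewrite /ht -big_split; apply: eq_bigr => i _; rewrite linearD. Qed.

Lemma htZ c x : ht (c *: x) = c * ht x.
Proof. by rewrite /ht mulr_sumr; apply: eq_bigr => i _; rewrite linearZ. Qed.

Lemma htN x : ht (- x) = - ht x.
Proof. by rewrite -scaleN1r htZ mulN1r. Qed.

Lemma coord_simple (i j : 'I_n) : coord simple i (tnth simple j) = (i == j)%:R.
Proof.
have [/basis_free fr _ _] := hsimple.
by rewrite (tnth_nth 0) coord_free // eq_sym.
Qed.

Lemma ht_simple i : ht (tnth simple i) = 1.
Proof.
rewrite /ht (bigD1 i) //= coord_simple eqxx big1 ?addr0 // => j ji.
by rewrite coord_simple (negPf ji).
Qed.

Lemma ht_comb (c : 'I_n -> nat) :
  ht (\sum_(i < n) tnth simple i *+ c i) = (\sum_(i < n) c i)%:R.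
Proof.
rewrite natr_sum.
have -> : ht (\sum_(i < n) tnth simple i *+ c i) =
    \sum_(i < n) ht (tnth simple i *+ c i).
  apply: (big_morph ht htD); by rewrite -(scale0r 0) htZ mul0r.
by apply: eq_bigr => i _; rewrite -scaler_nat htZ ht_simple mulr1.
Qed.

Lemma nat_comb_ge0 v : nat_comb simple v -> 0 <= ht v.
Proof. by move=> [c ->]; rewrite ht_comb. Qed.

Lemma nat_comb_gt0 v : nat_comb simple v -> v != 0 -> 0 < ht v.
Proof.
move=> [c ->] v0; rewrite ht_comb ltr0n lt0n; apply: contra v0.
rewrite sum_nat_eq0 => /forallP c0.
by rewrite big1 // => i _; rewrite (eqP (c0 i)) mulr0n.
Qed.

Lemma root_nz a : Phi0 a -> a != 0.
Proof. by move=> Pa; apply/eqP => a0; apply: (root_neq0 hPhi0); rewrite -a0. Qed.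

Lemma root_sign a : Phi0 a ->
  (nat_comb simple a /\ 0 < ht a) \/ (nat_comb simple (- a) /\ ht a < 0).
Proof.
have [_ _ nc] := hsimple; move=> Pa; have a0 := root_nz Pa.
case: (nc a Pa) => na; [left|right]; split=> //; first exact: nat_comb_gt0.
by rewrite -oppr_gt0 -htN nat_comb_gt0 // oppr_eq0.
Qed.

Lemma pos_root0E a : pos_root0 Phi0 simple a <-> pos Phi0 ht a.
Proof.
split=> -[Pa]; last first.
  by move=> a0; split=> //; case: (root_sign Pa) => [[]//|[_]]; rewrite ltNge ltW.
by move=> na; split=> //; apply: nat_comb_gt0 => //; exact: root_nz.
Qed.

Lemma ht_int a : Phi0 a -> ht a \in Num.int.
Proof.
case/root_sign => -[[c cE] _]; first by rewrite cE ht_comb; apply: rpred_nat.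
by rewrite -rpredN -htN cE ht_comb; apply: rpred_nat.
Qed.

Lemma ht_neq0 a : Phi0 a -> ht a != 0.
Proof. by case/root_sign => -[_ h]; rewrite neq_lt h ?orbT. Qed.

Lemma ht_height : height_fun form Phi0 ht.
Proof.
split; [exact: htD|exact: htZ|exact: ht_int|exact: ht_neq0| | |].
- move=> b c Pb c0 /(root_reduced hPhi0 Pb)[//|c1].
  by move: c0; rewrite c1 ltNge lerN10.
- by move=> b Pb; apply: sub_finite_set (root_finite hPhi0) => c [[]].
- by move=> x /form_eq0.
Qed.

Lemma pos_simple_obtuse (B : V0 -> R) a :
  (forall x y, B (x + y) = B x + B y) -> nat_comb simple a -> 0 < B a ->
  exists i, 0 < B (tnth simple i).
Proof.
move=> BD [c ->] Ba; apply: contrapT => no; move: Ba.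
have B0 : B 0 = 0 by apply: (addrI (B 0)); rewrite -BD !addr0.
have BMn x k : B (x *+ k) = B x *+ k.
  by elim: k => [|k IH]; rewrite ?mulr0n // !mulrS BD IH.
rewrite (big_morph B BD B0) ltNge => /negP; apply.
apply: sumr_le0 => i _; rewrite BMn mulrn_wle0 // leNgt; apply/negP => h.
by apply: no; exists i.
Qed.

Lemma W0_refl a : Phi0 a -> W0 form simple (refl0 form a).
Proof.
move=> Pa; have [_ Ps _] := hsimple.
have := @generated_refl R V0 form form_semidot Phi0 ht root_refl_closed ht_height
  [set tnth simple i | i in setT] _ _ _ a Pa.
rewrite /W0 (_ : [set srefl _ _ | _ in _] = [set g | exists i, g = refl0 form (tnth simple i)]).
  apply=> [_ [i _ <-]|b c Pb Pc|b [Pb eb]].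
  - by split; [exact: Ps|exact: ht_simple].
  - exact: (root_int hPhi0).
  - have [//|||i bi] := @pos_simple_obtuse (form b) b.
    + by move=> x y; rewrite linearDr.
    + by case: (root_sign Pb) => [[]//|[_]]; rewrite ltNge ltW.
    + exact: root_gt0.
    by exists (tnth simple i) => //; exists i.
apply/seteqP; split=> [_ [_ [i _ <-] <-]|_ [i ->]]; first by exists i.
by exists (tnth simple i) => //; exists i.
Qed.

Lemma theta_comb : nat_comb simple theta.
Proof.
have [Pt tmax] := htheta; case: (root_sign Pt) => [[]//|[_ neg]].
have := nat_comb_ge0 (tmax _ (rootN Pt)); rewrite opprK htD => h.
by exfalso; move: neg h; lra.
Qed.

(** The height for the affine base: the coefficient of [delta] is chosen so that
    [alpha_0 = delta - theta] has height 1, like the other simple roots. The value at [delta] is the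
    Coxeter number. *)
Definition ell (b : affV V0) : R := ht b.1 + b.2 * (1 + ht theta).

Lemma ellD x y : ell (x + y) = ell x + ell y.
Proof. rewrite /ell /= htD; ring. Qed.

Lemma ellZ c x : ell (c *: x) = c * ell x.
Proof. rewrite /ell /= htZ -[c *: x.2]/(c * x.2); ring. Qed.

Lemma ellN x : ell (- x) = - ell x.
Proof. by rewrite -scaleN1r ellZ mulN1r. Qed.

Lemma ht_theta_ge a : Phi0 a -> `|ht a| <= ht theta.
Proof.
have [Pt tmax] := htheta => Pa.
have := nat_comb_ge0 (tmax _ Pa); have := nat_comb_ge0 (tmax _ (rootN Pa)).
by rewrite opprK !htD htN => h1 h2; rewrite ler_norml; apply/andP; split; lra.
Qed.

Lemma ht_theta_ge0 : 0 <= ht theta.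
Proof. exact/nat_comb_ge0/theta_comb. Qed.

Lemma ell_ge1 a (k : int) : Phi0 a -> 1 <= k -> 0 < ell (a, k%:~R).
Proof.
move=> Pa k1; have := ht_theta_ge Pa; rewrite ler_norml => /andP[h _].
have k1R : (1 : R) <= k%:~R by rewrite ler1z.
have := ht_theta_ge0; rewrite /ell /=; nra.
Qed.

Lemma Phi_N b : Phi Phi0 b -> Phi Phi0 (- b).
Proof.
move=> [a [k [Pa ->]]]; exists (- a), (- k); split; first exact: rootN.
by rewrite rmorphN.
Qed.

(** Turns the two clauses of [Phi_pos] into positivity of one linear function, as the abstract
    sections require. *)
Lemma Phi_posE b : Phi_pos Phi0 simple b <-> pos (Phi Phi0) ell b.
Proof.
split=> [[[a /pos_root0E[Pa a0] ->]|[a [k [Pa k1 ->]]]]|[[a [k [Pa ->]]] e0]].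
- by split; [exists a, 0|rewrite /ell /= mul0r addr0].
- by split; [exists a, k|exact: ell_ge1].
have [k1|k1] := leP 1 k; first by right; exists a, k.
have [kn|kp] := ltP k 0.
  have nk1 : 1 <= - k by lia.
  have := ell_ge1 (rootN Pa) nk1.
  have -> : (- a, (- k)%:~R) = - (a, k%:~R) :> affV V0 by rewrite rmorphN.
  by rewrite ellN oppr_gt0 => /ltW; rewrite leNgt e0.
have kE : k = 0 by lia.
left; exists a; last by rewrite kE.
by apply/pos_root0E; split=> //; move: e0; rewrite kE /ell /= mul0r addr0.
Qed.

Lemma finite_affine (X : set (affV V0)) : X `<=` Phi Phi0 ->
  (forall a, Phi0 a -> exists C : nat, forall k : int,
     X (a, k%:~R) -> (`|k| <= C)%N) -> finite_set X.
Proof.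
move=> XP Xb.
have sub : X `<=` \bigcup_(a in Phi0) [set b | b.1 = a /\ X b].
  by move=> b Xb'; have [a [k [Pa bE]]] := XP _ Xb'; exists a => //; rewrite bE in Xb' *.
apply: sub_finite_set sub _; apply: bigcup_finite => [|a Pa].
  exact: (root_finite hPhi0).
have [C hC] := Xb a Pa.
pose f (i : nat) : affV V0 := (a, (i%:Z - C%:Z)%:~R).
apply: (@sub_finite_set _ _ (f @` `I_(C + C).+1)); last first.
  by apply: finite_image; exact: finite_II.
move=> b [/= ba Xb']; have [a' [k [Pa' bE]]] := XP _ Xb'.
move: ba Xb'; rewrite bE /= => -> /hC kC.
exists (absz (k + C%:Z)) => /=; first lia.
by rewrite /f; congr (_, _%:~R); lia.
Qed.

Lemma finite_affine_bound (X : set (affV V0)) : finite_set X ->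
  exists C : nat, forall a (k : int), X (a, k%:~R) -> (`|k| <= C)%N.
Proof.
move=> /finite_seqP[s ->]; elim: s => [|b s [C hC]]; first by exists 0%N.
have [k0 k0b] : exists D : nat, forall k : int, b.2 = k%:~R -> (`|k| <= D)%N.
  have [[k kb]|no] := pselect (exists k : int, b.2 = k%:~R).
    by exists `|k|%N => l; rewrite kb => /intr_inj->.
  by exists 0%N => k kb; exfalso; apply: no; exists k.
exists (maxn k0 C) => a k /=; rewrite inE leq_max => /orP[/eqP ab|/hC->]; last exact: orbT.
by rewrite k0b // -ab.
Qed.

(** * Reflections and automorphisms of the affine root system *)

Notation Af := (affform form).

Lemma reflE b x : refl form b x = x - (2 * Af x b / Af b b) *: b.
Proof. exact: (sreflE affform_semidot). Qed.

Lemma affcryst b c : Phi Phi0 b -> Phi Phi0 c -> 2 * Af c b / Af b b \in Num.int.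
Proof.
by move=> [a [k [Pa ->]]] [a' [k' [Pa' ->]]]; apply: (root_int hPhi0).
Qed.

Lemma Phi_refl_closed : refl_closed Af (Phi Phi0).
Proof.
split=> [_ [a [k [Pa ->]]]|b c Pb Pc]; first exact: root_gt0.
have [a [k [Pa ->]]] := Pb; have [a' [k' [Pa' ->]]] := Pc.
have /intrP[m mE] := root_int hPhi0 Pa Pa'.
exists (refl0 form a a'), (k' - m * k); split; first exact: (root_refl hPhi0).
rewrite -[srefl _ _]/(refl form (a, k%:~R)) reflE /affform /= mE.
rewrite (sreflE form_semidot) mE rmorphB rmorphM; congr (_, _).
Qed.

Lemma refl_delta b : refl form b (0, 1) = (0, 1).
Proof. by rewrite reflE /affform /= linear0l mulr0 mul0r scale0r subr0. Qed.

Lemma affVE a (r : R) : (a, r) = (a, 0) + r *: (0, 1) :> affV V0.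
Proof. by congr (_, _); rewrite /= ?scaler0 ?addr0 // add0r -[_ *: _]/(_ * _) mulr1. Qed.

Definition affine_aut (g : 'End(affV V0)) : Prop :=
  [/\ g (0, 1) = (0, 1), forall b, Phi Phi0 b -> Phi Phi0 (g b)
    & forall x y, Af (g x) (g y) = Af x y].

Lemma affine_autE g a (r : R) : affine_aut g -> g (a, r) = g (a, 0) + r *: (0, 1).
Proof. by case=> gd _ _; rewrite affVE linearD linearZ /= gd. Qed.

Lemma affine_aut_refl b : Phi Phi0 b -> affine_aut (refl form b).
Proof.
move=> Pb; split; first exact: refl_delta.
  by move=> c Pc; apply: (rc_refl Phi_refl_closed).
by move=> x y; apply: (srefl_isom affform_semidot); apply: (rc_gt0 Phi_refl_closed).
Qed.

Lemma refl_invol b x : Phi Phi0 b -> refl form b (refl form b x) = x.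
Proof. by move=> Pb; apply: (sreflK affform_semidot); apply: (rc_gt0 Phi_refl_closed). Qed.

Definition refl_set (S : set 'End(affV V0)) : Prop :=
  S `<=` [set g | exists2 b, Phi Phi0 b & g = refl form b].

Lemma generated_affine_aut S g : refl_set S -> generated S g -> affine_aut g.
Proof.
move=> RS; apply: generated_ind.
- by move=> s x /RS[b Pb ->]; apply: refl_invol.
- by split=> [|b|x y]; rewrite ?id_lfunE.
- move=> s h /RS[b Pb ->] [hd hP hB].
  have [sd sP sB] := affine_aut_refl Pb.
  by split=> [|c Pc|x y]; rewrite !comp_lfunE ?hd ?sB //; apply/sP/hP.
Qed.

Lemma refl_set_inv S g : refl_set S -> generated S g ->
  [/\ generated S (g^-1)%VF, cancel g (g^-1)%VF & cancel (g^-1)%VF g].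
Proof.
move=> RS Sg; have [_ _ GV] := generated_subgroup S.
have [||gK gVK] := @generated_inv _ _ S _ g; last by split=> //; apply: GV.
  by move=> s x /RS[b Pb ->]; apply: refl_invol.
by [].
Qed.

Lemma ell_delta : ell (0, 1) = 1 + ht theta.
Proof. by rewrite /ell /= -[X in ht X](scale0r 0) htZ mul0r add0r mul1r. Qed.

(** As [g] fixes [delta], both heights are affine functions of [k] with the same slope
    [1 + ht theta], at least 1. Their signs can differ only between their zeros. *)
Lemma sign_change_bound g a : affine_aut g ->
  exists C : nat, forall k : int,
    0 < ell (a, k%:~R) -> ell (g (a, k%:~R)) < 0 -> (`|k| <= C)%N.
Proof.
move=> ag; pose M := `|ht a| + `|ell (g (a, 0))|.
exists (Num.trunc M).+1 => k.
rewrite affine_autE // ellD ellZ ell_delta {1}/ell /=.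
have t0 := ht_theta_ge0; set e := ell (g (a, 0)) in M *.
have ha := ler_norm (ht a); have he := ler_norm (- e); rewrite normrN in he.
have ha0 := normr_ge0 (ht a); have he0 := normr_ge0 e.
move=> h1 h2; rewrite -(ler_nat R) natr_absz intr_norm.
apply: le_trans (ltW (truncnS_gt M)); rewrite /M.
have [k0|k0] := leP 0 (k%:~R : R).
  rewrite ger0_norm //; nra.
by rewrite ltr0_norm //; nra.
Qed.

Lemma sign_change_finite g : affine_aut g ->
  finite_set [set b | pos (Phi Phi0) ell b /\ ell (g b) < 0].
Proof.
move=> ag; apply: finite_affine => [b [[]//]|a Pa].
have [C hC] := sign_change_bound a ag.
by exists C => k [[_ h1] h2]; apply: hC.
Qed.

Lemma Phi_height : height_fun Af (Phi Phi0) ell.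
Proof.
have hP b : Phi Phi0 b -> exists (k l : int), [/\ ht b.1 = k%:~R, b.2 = l%:~R &
    exists t : int, ht theta = t%:~R].
  move=> [a [l [Pa ->]]]; have /intrP[k kE] := ht_int Pa.
  have [Pt _] := htheta; have /intrP[t tE] := ht_int Pt.
  by exists k, l; split=> //; exists t.
split; [exact: ellD|exact: ellZ| | | | |].
- move=> b /hP[k [l [kE lE [t tE]]]]; rewrite /ell kE lE tE.
  by rewrite rpredD ?rpredM ?rpredD ?rpred1 ?intr_int.
- move=> b [a [k [Pa bE]]].
  have [k1|k1] := leP 1 k; first by rewrite bE gt_eqF // ell_ge1.
  have [kn|kp] := ltP k 0.
    have nk1 : 1 <= - k by lia.
    have := ell_ge1 (rootN Pa) nk1.
    have -> : (- a, (- k)%:~R) = - b by rewrite bE rmorphN.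
    by rewrite ellN oppr_gt0 => /lt_eqF->.
  have kE : k = 0 by lia.
  by rewrite bE kE /ell /= mul0r addr0 ht_neq0.
- move=> b c [a [k [Pa ->]]] c0 [a' [k' [Pa' [ca _]]]].
  have : Phi0 (c *: a) by rewrite ca.
  move=> /(root_reduced hPhi0 Pa)[//|c1].
  by move: c0; rewrite c1 ltNge lerN10.
- move=> b Pb; exact: (sign_change_finite (affine_aut_refl Pb)).
- move=> [x r] /form_eq0 /= x0; rewrite /ell /= x0 -[X in ht X](scale0r 0) htZ mul0r add0r.
  move=> /eqP; rewrite mulf_eq0 => /orP[/eqP->//|/eqP h].
  by exfalso; have := ht_theta_ge0; move: h {x0}; lra.
Qed.

Lemma height_sub Psi : refl_closed Af Psi -> Psi `<=` Phi Phi0 ->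
  height_fun Af Psi ell.
Proof.
move=> rP PP; have [h1 h2 h3 h4 h5 h6 h7] := Phi_height.
split=> //; try by move=> b /PP; auto.
- by move=> b c /PP Pb c0 /PP; apply: h5.
- by move=> b /PP Pb; apply: sub_finite_set (h6 b Pb) => c [[/PP]].
Qed.

Lemma W_refl b : Phi Phi0 b -> W form simple theta (refl form b).
Proof.
move=> Pb; have [_ Ps _] := hsimple; have [Pt _] := htheta.
pose Delta : set (affV V0) :=
  [set (tnth simple i, 0) | i in setT] `|` [set (- theta, 1)].
have := @generated_refl R (affV V0) Af affform_semidot (Phi Phi0) ell
  Phi_refl_closed Phi_height Delta _ affcryst _ b Pb.
rewrite /W (_ : [set srefl _ _ | _ in _] =
   ([set g | exists i, g = refl form (tnth simple i, 0)] `|`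
             [set refl form (- theta, 1)])).
  apply=> [_ [[i _ <-]|->]|{Pb b} b [[a [k [Pa ->]]] eb]].
  - by split; [exists (tnth simple i), 0|rewrite /ell /= ht_simple mul0r addr0].
  - split; last by rewrite /ell /= htN; ring.
    by exists (- theta), 1; split; first exact: rootN.
  - have ak0 : 0 < Af (a, k%:~R) (a, k%:~R) by apply: root_gt0.
    (* If no affine simple root has a positive product with [a], then [form a theta] is both
       nonnegative and nonpositive. But [theta + a] is also a nonnegative combination of simple
       roots, whence [form a a <= 0]. *)
    apply: contrapT => no.
    have obt v : nat_comb simple v -> form a v <= 0.
      move=> nv; rewrite leNgt; apply/negP => av.
      have [x y|i ai] := @pos_simple_obtuse (form a) v _ nv av; first exact: linearDr.
      by apply: no; exists (tnth simple i, 0) => //; left; exists i.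
    have at0 : 0 <= form a theta.
      rewrite leNgt; apply/negP => at0; apply: no; exists (- theta, 1); first by right.
      by rewrite /affform /= linearNr oppr_gt0.
    have at0' : form a theta = 0 by apply/eqP; rewrite eq_le at0 andbT; exact/obt/theta_comb.
    have [_ tmax] := htheta; have := obt _ (tmax _ (rootN Pa)).
    by rewrite opprK (sdotDr form_semidot) at0' add0r leNgt root_gt0.
apply/seteqP; split=> [_ [_ [[i _ <-]|->] <-]|_ [[i ->]|->]].
- by left; exists i.
- by right.
- by exists (tnth simple i, 0) => //; left; exists i.
- by exists (- theta, 1) => //; right.
Qed.

Lemma W_refl_set : refl_set ([set g | exists i, g = refl form (tnth simple i, 0)] `|`
             [set refl form (- theta, 1)]).
Proof.
have [_ Ps _] := hsimple; have [Pt _] := htheta.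
move=> _ [[i ->]|->].
  by exists (tnth simple i, 0) => //; exists (tnth simple i), 0.
by exists (- theta, 1) => //; exists (- theta), 1; split; first exact: rootN.
Qed.

Lemma W_affine_aut g : W form simple theta g ->
  [/\ affine_aut (g^-1)%VF, cancel g (g^-1)%VF & cancel (g^-1)%VF g].
Proof.
move=> /(refl_set_inv W_refl_set)[Wg gK gVK]; split=> //.
exact: generated_affine_aut W_refl_set Wg.
Qed.

Lemma N_E g b : W form simple theta g ->
  (N Phi0 simple g b <-> pos (Phi Phi0) ell b /\ ell ((g^-1)%VF b) < 0).
Proof.
move=> /W_affine_aut[[_ gP _] _ _]; split=> -[].
  by move=> /Phi_posE pb /Phi_posE[_]; rewrite ellN oppr_gt0.
move=> pb neg; split; apply/Phi_posE => //; split; last by rewrite ellN oppr_gt0.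
by apply/Phi_N/gP; case: pb.
Qed.

Lemma N_finite g : W form simple theta g -> finite_set (N Phi0 simple g).
Proof.
move=> Wg; have [ag _ _] := W_affine_aut Wg.
by apply: sub_finite_set (sign_change_finite ag) => b /(N_E _ Wg).
Qed.

(** * Faces of the Coxeter fan *)

Lemma W0_aut g : W0 form simple g ->
  [/\ W0 form simple (g^-1)%VF, forall a, Phi0 a -> Phi0 (g a),
      cancel g (g^-1)%VF & cancel (g^-1)%VF g].
Proof.
have [_ Ps _] := hsimple.
have inv s x : (exists i, s = refl0 form (tnth simple i)) -> s (s x) = x.
  by move=> [i ->]; apply: (sreflK form_semidot); apply: root_gt0.
move=> Wg; have [gK gVK] := generated_inv inv Wg; split=> //.
  have [_ _ GV] := generated_subgroup [set g | exists i, g = refl0 form (tnth simple i)].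
  exact: GV.
elim/(generated_ind inv): g / Wg {gK gVK} => [a|s g [i ->] gP a Pa]; first by rewrite id_lfunE.
by rewrite comp_lfunE; apply: (root_refl hPhi0) => //; apply: gP.
Qed.

Lemma chamberE C : chamber form Phi0 simple C <-> exists2 g, W0 form simple g &
  C = [set k : dualV V0 | forall a, pos_root0 Phi0 simple a -> 0 <= k (g a)].
Proof.
split=> -[g Wg ->]; exists g => //; have [_ _ gK gVK] := W0_aut Wg.
  apply/seteqP; split=> [_ [f df <-] a pa|k kp]; first by rewrite comp_lfunE /= gK; apply: df.
  exists (k \o g)%VF; first by move=> a pa; rewrite comp_lfunE /=; apply: kp.
  by apply/lfunP => x; rewrite !comp_lfunE gVK.
apply/seteqP; split=> [k kp|_ [f df <-] a pa]; last by rewrite comp_lfunE /= gK; apply: df.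
exists (k \o g)%VF; first by move=> a pa; rewrite comp_lfunE /=; apply: kp.
by apply/lfunP => x; rewrite !comp_lfunE gVK.
Qed.

Lemma chamber_sign C a : chamber form Phi0 simple C -> Phi0 a ->
  (forall k : dualV V0, C k -> 0 <= k a) \/ (forall k : dualV V0, C k -> k a <= 0).
Proof.
move=> /chamberE[g Wg ->] Pa; have [/W0_aut[_ gVP _ _] _ _ gVK] := W0_aut Wg.
have [[na _]|[na _]] := root_sign (gVP _ Pa); [left|right] => k kp.
  by rewrite -[a]gVK; apply: kp; split=> //; apply: gVP.
rewrite -oppr_ge0 -functionalN -[a]gVK -linearN; apply: kp; split=> //.
exact/rootN/gVP.
Qed.

(** Applied to both [a] and [- a], the condition forces [k a = 0] wherever [f a = 0]: this is the
    closed face with [f] in its relative interior. *)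
Definition sign_cone (f : dualV V0) : set (dualV V0) :=
  [set k | forall a, Phi0 a -> 0 <= f a -> 0 <= k a].

Lemma chamber_sign_cone C f : chamber form Phi0 simple C -> C f -> sign_cone f `<=` C.
Proof.
move=> /chamberE[g Wg ->] Cf k kf a pa; have [_ gP _ _] := W0_aut Wg.
by apply: kf; [apply: gP; case: pa | apply: Cf].
Qed.

(** The roots with [f > 0], ties being broken by [ht], form a half of the finite set [Phi0].
    [half_transitive] carries it to the standard positive system. *)
Lemma chamber_cover f : exists2 C, chamber form Phi0 simple C & C f.
Proof.
pose Q := [set a : V0 | 0 < f a \/ (f a = 0 /\ 0 < ht a)].
have hpos : halfset Phi0 (pos Phi0 ht) by exact: (half_pos form_semidot root_refl_closed ht_height).
have hQ : halfset Phi0 [set a : V0 | 0 < (f a : R) \/ ((f a : R) = 0 /\ pos Phi0 ht a)].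
  apply: halfset_lex; [exact: functionalD|exact: functionalZ|].
  by apply: halfset_sub hpos => a [].
have [|g Gg gE] := half_transitive form_semidot root_refl_closed hpos hQ.
  by apply: sub_finite_set (root_finite hPhi0) => a [].
have Wg : W0 form simple g.
  by apply: generated_sub Gg => _ [b Pb <-]; apply: W0_refl.
have [WgV _ gK gVK] := W0_aut Wg; have [_ gVP _ _] := W0_aut WgV.
exists [set k : dualV V0 | forall a, pos_root0 Phi0 simple a -> 0 <= k ((g^-1)%VF a)].
  by apply/chamberE; exists (g^-1)%VF.
move=> a /pos_root0E pa; have := gE _ (gVP _ pa.1); rewrite gVK => -[_ /(_ pa)].
by case=> [/ltW|[->]].
Qed.

(** Take a chamber through [f - e k] with [e] small. Roots positive on [f] stay positive, so the
    chamber contains [f]; a root with [f a >= 0 > k a] is positive at [f - e k], so the chamber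
    misses [k]. *)
Lemma separating_chamber f k : ~ sign_cone f k ->
  exists C, [/\ chamber form Phi0 simple C, C f & ~ C k].
Proof.
move=> /existsNP[a] /not_implyP[Pa] /not_implyP[fa /negP]; rewrite -ltNge => ka.
have [e e0 he] : exists2 e : R, 0 < e & forall b, Phi0 b -> 0 < f b -> 0 < f b - e * k b.
  pose A := [set b : V0 | Phi0 b /\ 0 < f b].
  have [none|/set0P ne] := eqVneq A set0.
    by exists 1 => // b Pb fb; have : A b by []; rewrite none.
  have fA : finite_set A by apply: sub_finite_set (root_finite hPhi0) => b [].
  (* The summand 1 keeps the denominator nonzero and makes [e * k b < f b] strict. *)
  have [m [Pm fm] mmin] := finite_min (fun b => f b / (1 + `|k b|) : R) fA ne.
  have D0 b : 0 < 1 + `|k b| :> R by rewrite ltr_pwDl.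
  have e0 : 0 < f m / (1 + `|k m|) :> R by rewrite divr_gt0.
  exists (f m / (1 + `|k m|)) => // b Pb fb.
  have := mmin b (conj Pb fb); rewrite ler_pdivlMr //.
  set e := f m / _ in e0 *; have := ler_norm (k b : R) => kb eb; nra.
have hE b : (f - e *: k) b = f b - e * k b :> R by rewrite !(add_lfunE, opp_lfunE, scale_lfunE).
have [C cC Ch] := chamber_cover (f - e *: k).
have sgn b : Phi0 b -> (forall l : dualV V0, C l -> l b <= 0) -> (f b : R) <= 0.
  move=> Pb neg; rewrite leNgt; apply/negP => fb.
  by have := neg _ Ch; rewrite hE leNgt he.
exists C; split=> //.
  move: (cC) => /chamberE[g Wg CE]; rewrite CE => b pb; have [_ gP _ _] := W0_aut Wg.
  rewrite -oppr_le0 -functionalN; apply: sgn; first by apply/rootN/gP; case: pb.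
  by move=> l; rewrite CE functionalN oppr_le0; apply.
move=> Ck; case: (chamber_sign cC Pa) => [/(_ _ Ck)|/(_ _ Ch)].
  by rewrite leNgt ka.
rewrite hE; move: fa ka => /=; nra.
Qed.

Lemma sign_cone_face f : face form Phi0 simple (sign_cone f).
Proof.
exists [set C | chamber form Phi0 simple C /\ C f]; split.
- by have [C cC Cf] := chamber_cover f; exists C.
- by move=> C [].
apply/seteqP; split=> [k kf C [cC Cf]|k kC]; first exact: (chamber_sign_cone cC Cf).
apply: contrapT => /separating_chamber[C [cC Cf]]; apply; exact: kC.
Qed.

(** The point at issue is a root with [f a = 0]. Moving from [f] slightly away from [k], to
    [f + t (f - k)], stays in [F] by relative interiority and reverses the sign of [k a], while a
    chamber allows only one sign. *)
Lemma relint_sign_cone F f : face form Phi0 simple F -> relint simple F f ->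
  F = sign_cone f.
Proof.
move=> [Cs [[C0 C0s] sCs ->]] [Ff [e e0 he]]; apply/seteqP; split=> k Fk; last first.
  by move=> C CsC; apply: (chamber_sign_cone (sCs _ CsC)) Fk; apply: Ff.
move=> a Pa fa.
have [//|neg] := chamber_sign (sCs _ C0s) Pa; first by apply; apply: Fk.
have fa0 : f a = 0 :> R by apply/eqP; rewrite eq_le fa neg //; apply: Ff.
pose D : R := \sum_(i < n) `|(f - k) (tnth simple i)|.
have D0 : 0 <= D by apply: sumr_ge0.
pose t := e / (1 + D); have t0 : 0 < t by rewrite divr_gt0 // ltr_pwDl.
have tD : t * D < e.
  by rewrite /t mulrAC ltr_pdivrMr ?ltr_pwDl // ltr_pM2l // ltrDr.
pose h : dualV V0 := f + t *: (f - k).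
have hE x : h x = f x + t * (f - k) x :> R by rewrite !(add_lfunE, opp_lfunE, scale_lfunE).
have Fh : (\bigcap_(C in Cs) C) h.
  apply: he => [|i].
    exists 2%N, (fun i => if i == ord0 then 1 + t else - t), (fun i => if i == ord0 then f else k).
    split=> [i||]; first by case: ifP.
      by rewrite !big_ord_recl big_ord0 /=; ring.
    rewrite !big_ord_recl big_ord0 /= addr0 /h scalerBr scalerDl scale1r scaleNr addrA.
    by [].
  rewrite hE addrC addKr normrM gtr0_norm //; apply: le_lt_trans tD.
  rewrite ler_pM2l // /D (bigD1 i) //= lerDl; exact: sumr_ge0.
have := neg _ (Fh _ C0s); rewrite hE fa0 add0r pmulr_rle0 //.
by rewrite add_lfunE opp_lfunE fa0 add0r oppr_le0.
Qed.

(** * Components and biclosed sets *)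

(** Replaces unions of components: orthogonality to the complement is all that is used later. *)
Definition orth_summand (X Z : set (affV V0)) : Prop :=
  Z `<=` X /\ forall y z, Z y -> (X `\` Z) z -> Af y z = 0.

(** The component is the intersection of all orthogonal summands through [x]; an orthogonal
    splitting of it would yield a smaller one. *)
Lemma component_of X x : X x -> exists2 Y, component form X Y & Y x.
Proof.
move=> Xx; pose Y := [set y | X y /\ forall Z, orth_summand X Z -> Z x -> Z y].
have Yx : Y x by split.
have orthY y z : Y y -> (X `\` Y) z -> Af y z = 0.
  move=> [Xy Yy] [Xz /not_andP[//|/existsNP[Z /not_implyP[oZ /not_implyP[Zx nZz]]]]].
  by apply: oZ.2 => //; apply: Yy.
exists Y => //; split; [by move=> y [] | split; first by exists x | exact: orthY].
have half_case A B : A `|` B = Y -> A `&` B = set0 ->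
    (forall a b, A a -> B b -> Af a b = 0) -> A x -> B = set0.
  move=> AB AB0 orthAB Ax; have AY : A `<=` Y by rewrite -AB => y; left.
  have oA : orth_summand X A.
    split=> [y /AY[]//|y z Ay [Xz nAz]].
    have [Yz|nYz] := pselect (Y z); last by apply: orthY; [exact: AY|].
    by apply: orthAB => //; move: Yz; rewrite -AB => -[].
  apply/seteqP; split=> // b Bb; rewrite -AB0; split=> //.
  have [_] : Y b by rewrite -AB; right.
  exact.
move=> A B AB AB0 orthAB; have : Y x by []; rewrite -AB => -[Ax|Bx].
  by right; apply: half_case AB AB0 orthAB Ax.
left; apply: (half_case B A) => //; [by rewrite setUC | by rewrite setIC |].
by move=> a b Ba Ab; rewrite (sdotC affform_semidot); apply: orthAB.
Qed.

(** An orthogonal summand cuts each component into two orthogonal parts, so it contains every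
    component that it meets. *)
Lemma union_of_componentsP X X' :
  union_of_components form X X' <-> orth_summand X X'.
Proof.
split=> [[Ys Ysc ->]|[sX oX]].
  split=> [y [Y YsY Yy]|y z [Y YsY Yy] [Xz nz]]; have [YX _ orthY] := Ysc _ YsY.
    exact: YX.
  by apply: orthY => //; split=> // Yz; apply: nz; exists Y.
exists [set Y | component form X Y /\ Y `<=` X'] => [Y []//|].
apply/seteqP; split=> [x X'x|x [Y [_ YX'] /YX']//].
have [Y cY Yx] := component_of (sX _ X'x); exists Y => //; split=> //.
have [YX [_ indY] orthY] := cY.
have [|||A0|B0] := indY (Y `&` X') (Y `\` X').
- apply/seteqP; split=> [y [[]//|[]//]|y Yy].
  by have [?|?] := pselect (X' y); [left|right].
- by apply/seteqP; split=> // y [[_ ?] [_ ?]].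
- by move=> a b [_ X'a] [Yb nb]; apply: oX => //; split=> //; apply: YX.
- by have : (Y `&` X') x by []; rewrite A0.
- by move=> y Yy; apply: contrapT => ny; have : (Y `\` X') y by []; rewrite B0.
Qed.

Lemma extE (f : dualV V0) b : ext f b = f b.1.
Proof.
pose h (v : affV V0) : R^o := f v.1.
have lh : linear h by move=> c u v; rewrite /h /= linearP.
pose g : {linear affV V0 -> R^o} :=
  HB.pack h (GRing.isLinear.Build R (affV V0) R^o _ h lh).
exact: (lfunE g).
Qed.

Lemma Phi_fE f b : Phi_ Phi0 f b <-> Phi Phi0 b /\ f b.1 = 0.
Proof. by rewrite /Phi_ /= extE. Qed.

Lemma Phi_f_sub f : Phi_ Phi0 f `<=` Phi Phi0.
Proof. by move=> b []. Qed.

Lemma Phi_f_refl_closed f : refl_closed Af (Phi_ Phi0 f).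
Proof.
split=> [b [Pb _]|b c /Phi_fE[Pb fb] /Phi_fE[Pc fc]]; first exact: (rc_gt0 Phi_refl_closed).
apply/Phi_fE; split; first exact: (rc_refl Phi_refl_closed).
by rewrite (sreflE affform_semidot) /= linearB linearZ /= fb fc scaler0 subrr.
Qed.

Section Summand.
Variables (f : dualV V0) (X' : set (affV V0)).
Hypothesis oX : orth_summand (Phi_ Phi0 f) X'.

Lemma summand_nonorth x y : Phi_ Phi0 f x -> Phi_ Phi0 f y -> Af x y <> 0 ->
  X' x -> X' y.
Proof. by move=> Px Py xy X'x; apply: contrapT => ny; apply/xy/oX.2. Qed.

Lemma summandN x : Phi_ Phi0 f x -> X' x -> X' (- x).
Proof.
move=> Px; have x0 := rc_gt0 (Phi_f_refl_closed f) Px.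
apply: summand_nonorth => //.
  exact: (refl_closedN affform_semidot (Phi_f_refl_closed f)).
by rewrite (sdotNr affform_semidot) => /eqP; rewrite oppr_eq0 gt_eqF.
Qed.

Lemma summand_srefl b x : Phi_ Phi0 f b -> Phi_ Phi0 f x -> X' x ->
  X' (srefl Af b x).
Proof.
move=> Pb Px X'x; have rc := Phi_f_refl_closed f.
have Psx : Phi_ Phi0 f (srefl Af b x) by apply: (rc_refl rc).
have [bx|bx] := eqVneq (Af x b) 0; first by rewrite (srefl_fix affform_semidot).
have b0 := rc_gt0 rc Pb.
have X'b : X' b by apply: summand_nonorth X'x => //; apply/eqP.
apply: summand_nonorth X'b => //.
rewrite -(srefl_isom affform_semidot _ _ b0) (sreflK affform_semidot) //.
rewrite (srefl_id affform_semidot) // (sdotNl affform_semidot) (sdotC affform_semidot).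
by apply/eqP; rewrite oppr_eq0.
Qed.

(** If one of the three roots were on the other side of [X'] from the remaining two, it would be
    orthogonal to them, and pairing the relation with it would make its norm vanish. *)
Lemma summand_comb x y z (s t : R) : Phi_ Phi0 f x -> Phi_ Phi0 f y ->
  Phi_ Phi0 f z -> 0 < s -> 0 < t -> z = s *: x + t *: y ->
  (X' x <-> X' z) /\ (X' y <-> X' z).
Proof.
move=> Px Py Pz s0 t0 zE; have gt0 := rc_gt0 (Phi_f_refl_closed f).
have C := sdotC affform_semidot.
have zx : Af z x = s * Af x x + t * Af x y.
  by rewrite zE (sdotDl affform_semidot) !(sdotZl affform_semidot) [Af y x]C.
have zy : Af z y = s * Af x y + t * Af y y.
  by rewrite zE (sdotDl affform_semidot) !(sdotZl affform_semidot).
have zz : Af z z = s * Af z x + t * Af z y.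
  by rewrite {2}zE (sdotDr affform_semidot) !(sdotZr affform_semidot).
have [[x0 y0] z0] := (gt0 _ Px, gt0 _ Py, gt0 _ Pz).
have [sx ty] : 0 < s * Af x x /\ 0 < t * Af y y by rewrite !mulr_gt0.
have orth u v : Phi_ Phi0 f v -> X' u -> ~ X' v -> Af u v = 0.
  by move=> Pv X'u nv; apply: oX.2.
have [X'z|nz] := pselect (X' z).
  suff [X'x X'y] : X' x /\ X' y by do !split.
  have [X'x|nx] := pselect (X' x); have [X'y|ny] := pselect (X' y) => //; exfalso.
  - by move: zy ty; rewrite (orth z y) // (orth x y) // mulr0 add0r => <-; rewrite ltxx.
  - by move: zx sx; rewrite [Af x y]C (orth z x) // (orth y x) // mulr0 addr0 => <-; rewrite ltxx.
  - by move: zz z0; rewrite (orth z x) // (orth z y) // !mulr0 addr0 => ->; rewrite ltxx.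
suff [nx ny] : ~ X' x /\ ~ X' y by do !split.
have [X'x|nx] := pselect (X' x); have [X'y|ny] := pselect (X' y) => //; exfalso.
- move: zz z0; rewrite [Af z x]C [Af z y]C (orth x z) // (orth y z) //.
  by rewrite !mulr0 addr0 => ->; rewrite ltxx.
- by move: zx sx; rewrite [Af z x]C (orth x z) // (orth x y) // mulr0 addr0 => <-; rewrite ltxx.
- by move: zy ty; rewrite [Af x y]C [Af z y]C (orth y z) // (orth y x) // mulr0 add0r => <-; rewrite ltxx.
Qed.

(** This is the half [ell (g x) > 0] on [X'] and the opposite half off [X']; by [summand_comb] no
    positive relation mixes the two. *)
Lemma summand_half g : affine_aut g ->
  halfset (Phi_ Phi0 f) [set x | X' x <-> 0 < ell (g x)].
Proof.
move=> [_ gP _].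
have ne x : Phi_ Phi0 f x -> ell (g x) != 0.
  by move=> /Phi_f_sub/gP; exact: (hf_neq0 Phi_height).
split=> [x Px /=|x y z s t Px Py Pz /= Qx Qy s0 t0 zE].
  have PNx := refl_closedN affform_semidot (Phi_f_refl_closed f) Px.
  have -> : X' (- x) = X' x.
    apply/propext; split; last exact: summandN.
    by move/(summandN PNx); rewrite opprK.
  rewrite linearN ellN oppr_gt0.
  have := ne _ Px; rewrite neq_lt => /orP[h|h].
    rewrite h [0 < _]ltNge (ltW h) /=; split=> [h1 h2|h1]; first by have := h2.1 (h1.2 isT).
    by split=> // _; apply: contrapT => h2; apply: h1.
  rewrite h [_ < 0]ltNge (ltW h) /=; split=> [h1 h2|h1]; first by have := h1.1 (h2.2 isT).
  by split=> // h2; exfalso; apply: h1.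
have [xz yz] := summand_comb Px Py Pz s0 t0 zE.
have gz : ell (g z) = s * ell (g x) + t * ell (g y).
  by rewrite zE linearD !linearZ ellD !ellZ.
have [X'z|nz] := pselect (X' z); split=> //.
  by move=> _; rewrite gz addr_gt0 // mulr_gt0 //; [apply/Qx/xz | apply/Qy/yz].
move=> gz0; have nonpos u : X' u <-> 0 < ell (g u) -> X' u <-> X' z -> ell (g u) <= 0.
  by move=> Qu uz; rewrite leNgt; apply/negP => /Qu/uz.
have [gx gy] := (nonpos x Qx xz, nonpos y Qy yz).
by move: gz0; rewrite gz ltNge -[0]addr0 lerD // mulr_ge0_le0 // ltW.
Qed.

(** The two-sided form of [Bset], with [g] standing for the inverse of [w]. *)
Definition triple_half g : set (affV V0) :=
  [set x | 0 < (f x.1 : R) \/ ((f x.1 : R) = 0 /\ (X' x <-> 0 < ell (g x)))].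

Lemma triple_halfP g : affine_aut g -> halfset (Phi Phi0) (triple_half g).
Proof.
move=> ag; apply: (@halfset_lex R (affV V0) (Phi Phi0) _ (fun x => f x.1)).
- by move=> x y /=; rewrite functionalD.
- by move=> c x /=; rewrite functionalZ.
apply: halfset_sub (summand_half ag) => x [Px fx]; exact/Phi_fE.
Qed.

Lemma BsetE w x : W form simple theta w ->
  (Bset Phi0 simple f X' w x <-> pos (Phi Phi0) ell x /\ triple_half (w^-1)%VF x).
Proof.
move=> Ww; have [[_ wP _] _ _] := W_affine_aut Ww.
rewrite /Bset /setY /setU /setD /setI /= extE /triple_half /=.
rewrite (propext (Phi_posE x)) (propext (N_E x Ww)) (propext (Phi_fE f x)).
have pP : pos (Phi Phi0) ell x -> Phi Phi0 x by case.
have XP : X' x -> Phi Phi0 x /\ (f x.1 : R) = 0 by move=> /oX.1/Phi_fE.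
have fZ : 0 < (f x.1 : R) -> (f x.1 : R) <> 0 by move=> + f0; rewrite f0 ltxx.
have neg : Phi Phi0 x -> (ell ((w^-1)%VF x) < 0 <-> ~ 0 < ell ((w^-1)%VF x)).
  move=> Px; have := hf_neq0 Phi_height (wP _ Px); rewrite neq_lt => /orP[h|h];
    by rewrite h ltNge (ltW h); split.
move: pP XP fZ neg; move: (pos _ _ _) (Phi _ _) (X' x) (0 < _) (_ = _ :> R) (_ < 0) (0 < _).
move=> p P X g Z v A pP XP fZ neg.
have [?|?] := pselect P; have [?|?] := pselect X; have [?|?] := pselect A;
  have [?|?] := pselect g; tauto.
Qed.

End Summand.

(** * Passage between biclosed sets and halves *)

Lemma half_biclosed P : halfset (Phi Phi0) P ->
  biclosed Phi0 simple (P `&` pos (Phi Phi0) ell).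
Proof.
move=> [PN Pc]; split=> [x [_ /Phi_posE//]|a b c].
move=> /Phi_posE pa /Phi_posE pb /Phi_posE pc [s [t [s0 t0 cE]]].
have [[Pa Pb] Pc'] := (pa.1, pb.1, pc.1).
split=> [[Qa _] [Qb _]|nQa nQb [Qc _]].
  by split=> //; apply: (Pc a b c s t).
suff /PN : P (- c) by apply.
apply: (Pc (- a) (- b) (- c) s t) => //; try exact: Phi_N.
- by apply/PN => // Qa; apply: nQa.
- by apply/PN => // Qb; apply: nQb.
- by rewrite cE opprD !scalerN.
Qed.

Definition two_sided (B : set (affV V0)) : set (affV V0) :=
  [set x | (pos (Phi Phi0) ell x /\ B x) \/ (pos (Phi Phi0) ell (- x) /\ ~ B (- x))].

Lemma two_sidedE B x : pos (Phi Phi0) ell x -> (two_sided B x <-> B x).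
Proof.
move=> px; split; last by left.
by case=> [[]//|[[_]]]; rewrite ellN oppr_gt0 ltNge ltW //; case: px.
Qed.

(** According to the signs of the roots, the relation is rearranged into a positive relation among
    positive roots. [ell] excludes the two patterns where [z] opposes both [x] and [y]. *)
Lemma biclosed_half B : biclosed Phi0 simple B -> halfset (Phi Phi0) (two_sided B).
Proof.
move=> [_ Bc].
have posN x : Phi Phi0 x -> pos (Phi Phi0) ell x \/ pos (Phi Phi0) ell (- x).
  move=> Px; have := hf_neq0 Phi_height Px; rewrite neq_lt => /orP[h|h].
    by right; split; [exact: Phi_N | rewrite ellN oppr_gt0].
  by left.
have nposN x : pos (Phi Phi0) ell x -> ~ pos (Phi Phi0) ell (- x).
  by move=> [_ h] [_]; rewrite ellN oppr_gt0 ltNge ltW.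
have comb a b c (s t : R) : pos (Phi Phi0) ell a -> pos (Phi Phi0) ell b ->
    pos (Phi Phi0) ell c -> 0 < s -> 0 < t -> c = s *: a + t *: b ->
    (B a -> B b -> B c) /\ (~ B a -> ~ B b -> ~ B c).
  move=> pa pb pc s0 t0 cE; apply: Bc; try exact/Phi_posE.
  by exists s, t.
(* If [a - b] is proportional to [c], solve for [a]. *)
have solve (a b c : affV V0) (s t : R) : 0 < s -> c = s *: a - t *: b ->
    a = s^-1 *: c + (s^-1 * t) *: b.
  move=> s0 ->; rewrite scalerBr !scalerA mulVf ?lt0r_neq0 // scale1r subrK //.
split=> [x Px|x y z s t Px Py Pz Qx Qy s0 t0 zE].
  rewrite /two_sided /= opprK; have [px|px] := posN x Px; have npx := nposN _ px.
    by tauto.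
  by move: npx; rewrite opprK; have [?|?] := pselect (B (- x)); tauto.
have si0 : 0 < s^-1 by rewrite invr_gt0.
have ti0 : 0 < t^-1 by rewrite invr_gt0.
case: Qx => -[px Bx]; case: Qy => -[py By]; have [pz|pz] := posN z Pz.
- by left; split=> //; apply: (comb x y z s t _ _ _ _ _ _).1.
- exfalso; apply: (nposN (- z)) => //; rewrite opprK; split=> //.
  by rewrite zE ellD !ellZ addr_gt0 // mulr_gt0 //; [case: px | case: py].
- left; split=> //; apply: contrapT => nBz.
  apply: (comb z (- y) x s^-1 (s^-1 * t) _ _ _ _ _ _).2 Bx => //; first exact: mulr_gt0.
  by apply: solve => //; rewrite zE scalerN opprK.
- right; split=> // Bz; apply: By.
  apply: (comb x (- z) (- y) (t^-1 * s) t^-1 _ _ _ _ _ _).1 => //; first exact: mulr_gt0.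
  by rewrite zE opprD scalerDr !scalerN !scalerA mulVf ?lt0r_neq0 // scale1r addrA subrr add0r.
- left; split=> //; apply: contrapT => nBz.
  apply: (comb z (- x) y t^-1 (t^-1 * s) _ _ _ _ _ _).2 By => //; first exact: mulr_gt0.
  by apply: solve => //; rewrite zE scalerN opprK addrC.
- right; split=> // Bz; apply: Bx.
  apply: (comb y (- z) (- x) (s^-1 * t) s^-1 _ _ _ _ _ _).1 => //; first exact: mulr_gt0.
  by rewrite zE opprD scalerDr !scalerN !scalerA mulVf ?lt0r_neq0 // scale1r addrCA subrr addr0.
- exfalso; apply: (nposN z) => //; split; first exact: Phi_N.
  rewrite zE opprD -!scalerN ellD !ellZ addr_gt0 // mulr_gt0 //; [by case: px | by case: py].
- right; split=> //; apply: (comb (- x) (- y) (- z) s t _ _ _ _ _ _).2 => //.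
  by rewrite zE opprD !scalerN.
Qed.

(** * Classification *)

Lemma affN a (k : int) : (- a, (- k)%:~R) = - (a, k%:~R) :> affV V0.
Proof. by rewrite rmorphN. Qed.

Lemma PhiI a (k : int) : Phi0 a -> Phi Phi0 (a, k%:~R).
Proof. by move=> Pa; exists a, k. Qed.

Lemma form_functional c : exists f : dualV V0, forall x, f x = form c x :> R.
Proof.
pose h (v : V0) : R^o := form c v.
have lh : linear h.
  by move=> e u v; rewrite /h (sdotDr form_semidot) (sdotZr form_semidot).
pose g : {linear V0 -> R^o} := HB.pack h (GRing.isLinear.Build R V0 R^o _ h lh).
by exists (linfun g) => x; exact: (lfunE g).
Qed.

(* With S the set of roots [a] such that [P] meets [a + Z delta], a parabolic
   subset of Phi0, the functional is the scalar product with the sum of the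
   roots in [S] whose opposite is not in [S]. *)
Lemma parabolic_functional P : halfset (Phi Phi0) P ->
  exists f : dualV V0, forall a, Phi0 a ->
    (0 <= (f a : R) <-> exists k : int, P (a, k%:~R)).
Proof.
move=> [PN Pc]; pose S a := exists k : int, P (a, k%:~R).
have SN a : Phi0 a -> ~ S a -> S (- a).
  move=> Pa nS; exists (- 0); rewrite affN; apply/PN; first exact: PhiI.
  by move=> Pa0; apply: nS; exists 0.
have SD a b (m : int) : Phi0 a -> Phi0 b -> Phi0 (a + m%:~R *: b) -> 0 < m ->
    S a -> S b -> S (a + m%:~R *: b).
  move=> Pa Pb Pab m0 [k Sa] [l Sb]; exists (k + m * l).
  apply: (Pc (a, k%:~R) (b, l%:~R) _ 1 m%:~R) => //; try exact: PhiI.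
    by rewrite ltr0z.
  by rewrite scale1r rmorphD rmorphM.
pose Su a := S a /\ ~ S (- a).
(* The reflection adds a nonnegative multiple of [a]. If the opposite of the image were in [S],
   adding the same multiple of [a] to it would put [- c] in [S]. *)
have step a c : Phi0 a -> Phi0 c -> S a -> Su c -> form c a <= 0 ->
    Su (refl0 form a c).
  move=> Pa Pc' Sa [Sc nSc] ca.
  have [ca0|ca0] := eqVneq (form c a) 0; first by rewrite (srefl_fix form_semidot).
  have /intrP[m mE] := root_int hPhi0 Pa Pc'.
  have sE : refl0 form a c = c + (- m)%:~R *: a.
    by rewrite (sreflE form_semidot) mE rmorphN scaleNr.
  have m0 : 0 < - m.
    rewrite oppr_gt0 -(ltrz0 R) -mE pmulr_llt0 ?invr_gt0 ?root_gt0 //.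
    by rewrite pmulr_rlt0 // lt_neqAle ca0.
  have Psc := root_refl hPhi0 Pa Pc'.
  split; first by rewrite sE; apply: SD => //; rewrite -sE.
  move=> Sn; apply: nSc.
  have cE : - c = - refl0 form a c + (- m)%:~R *: a by rewrite sE opprD subrK.
  by rewrite cE; apply: SD => //; [exact: rootN | rewrite -cE; exact: rootN].
have /finite_seqP[s0 s0E] := root_finite hPhi0; pose r := undup s0.
have rE x : x \in r <-> Phi0 x by rewrite s0E mem_undup.
pose chi c : R := `[< Su c >]%:R.
have [f fE] := form_functional (\sum_(c <- r) chi c *: c).
have fS a : f a = \sum_(c <- r) chi c * form c a :> R.
  rewrite fE (big_morph (fun v => form v a) (id1 := 0) (op1 := +%R)).
  - by apply: eq_bigr => c _; rewrite (sdotZl form_semidot).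
  - by move=> x y; rewrite (sdotDl form_semidot).
  - by rewrite linear0l.
(* Adding to the sum its reindexing by [s_a] gives terms whose sign is controlled by [step]. *)
have key a : Phi0 a ->
    2 * f a = \sum_(c <- r) (chi c - chi (refl0 form a c)) * form c a :> R.
  move=> Pa; have a0 := root_gt0 Pa.
  have sK : cancel (refl0 form a) (refl0 form a).
    by move=> x; apply: (sreflK form_semidot).
  have rperm : perm_eq [seq refl0 form a c | c <- r] r.
    apply: uniq_perm; rewrite ?(map_inj_uniq (can_inj sK)) ?undup_uniq //.
    move=> x; apply/idP/idP => [/mapP[c /rE Pc' ->]|/rE Px].
      by apply/rE/(root_refl hPhi0).
    by apply/mapP; exists (refl0 form a x); [apply/rE/(root_refl hPhi0) | rewrite sK].
  have fS' : f a = - \sum_(c <- r) chi (refl0 form a c) * form c a :> R.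
    rewrite fS -(perm_big _ rperm) big_map -sumrN; apply: eq_bigr => c _ /=.
    rewrite -mulrN -(srefl_isom form_semidot c a a0) (srefl_id form_semidot) //.
    by rewrite (sdotNr form_semidot) opprK.
  rewrite mulrDl mul1r {1}fS {1}fS' -sumrB; apply: eq_bigr => c _.
  by rewrite mulrBl.
exists f => a Pa.
have fpos b : Phi0 b -> Su b -> 0 < (f b : R).
  move=> Pb [Sb nSb]; rewrite -(pmulr_rgt0 _ (ltr0n R 2)) key //.
  have b0 := root_gt0 Pb; have br : b \in r by apply/rE.
  have term c : c \in r -> 0 <= (chi c - chi (refl0 form b c)) * form c b.
    move=> /rE Pc'; have Psc := root_refl hPhi0 Pb Pc'.
    have [cb|cb] := leP (form c b) 0.
      rewrite mulr_le0 // subr_le0 ler_nat /chi; have [/asboolP Sc|//] := boolP `[< Su c >].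
      by rewrite asboolT //; apply: step.
    rewrite mulr_ge0 ?(ltW cb) // subr_ge0 ler_nat.
    have [/asboolP Ssc|//] := boolP `[< Su (refl0 form b c) >].
    rewrite asboolT // -[c](sreflK form_semidot _ b0); apply: step => //.
    rewrite -(srefl_isom form_semidot _ _ b0) (sreflK form_semidot) //.
    by rewrite (srefl_id form_semidot) // (sdotNr form_semidot) oppr_le0 ltW.
  rewrite (big_rem b) //= ltr_pwDl //; last first.
    by rewrite big_seq sumr_ge0 // => c /mem_rem/term.
  rewrite mulr_gt0 // /chi asboolT // asboolF ?subr0 //.
  by rewrite (srefl_id form_semidot) // => -[].
(* With [b] and [- b] both in [S], [Su] is stable under [s_b] and every term of [key] vanishes. *)
have fzero b : Phi0 b -> S b -> S (- b) -> (f b : R) = 0.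
  move=> Pb Sb SNb; apply: (mulfI (lt0r_neq0 (ltr0n R 2))); rewrite mulr0 key //.
  have b0 := root_gt0 Pb.
  have stepb c : Phi0 c -> Su c -> Su (refl0 form b c).
    move=> Pc' Suc; have [cb|cb] := leP (form c b) 0; first exact: step.
    rewrite -[refl0 form b](sreflN form_semidot); apply: step => //; first exact: rootN.
    by rewrite (sdotNr form_semidot) oppr_le0 ltW.
  rewrite big_seq big1 // => c /rE Pc'; rewrite /chi.
  rewrite (_ : Su (refl0 form b c) = Su c) ?subrr ?mul0r //.
  apply/propext; split=> [/(stepb _ (root_refl hPhi0 Pb Pc'))|]; last exact: stepb.
  by rewrite (sreflK form_semidot).
split=> [fa|Sa].
  apply: contrapT => nS; have SNa := SN _ Pa nS.
  have SuNa : Su (- a) by split=> //; rewrite opprK.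
  by have := fpos _ (rootN Pa) SuNa; rewrite functionalN oppr_gt0 ltNge fa.
have [SNa|nSNa] := pselect (S (- a)); first by rewrite fzero.
by apply/ltW/fpos.
Qed.

(** * Decomposition of a half *)

Lemma ell_bound a : exists D : nat, forall k : int,
  (0 < ell (a, k%:~R) -> - D%:Z <= k) /\ (~ 0 < ell (a, k%:~R) -> k <= D%:Z).
Proof.
exists (Num.trunc `|ht a|).+1 => k; set D := (Num.trunc _).+1.
have hD : `|ht a| < D%:~R by rewrite -pmulrn; exact: truncnS_gt.
have h1 := ler_norm (ht a); have h2 := ler_norm (- ht a); rewrite normrN in h2.
have t0 := ht_theta_ge0; have n0 := normr_ge0 (ht a).
rewrite /ell /=; split=> [|/negP]; last rewrite -leNgt; move=> hk.
  rewrite leNgt; apply/negP => kD.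
  have kDR : (k%:~R : R) < - D%:~R by rewrite -rmorphN ltr_int.
  by move: hk; rewrite ltNge => /negP; apply; nra.
rewrite leNgt; apply/negP => kD.
have kDR : D%:~R < (k%:~R : R) by rewrite ltr_int.
by move: hk; rewrite leNgt => /negP; apply; nra.
Qed.

Lemma affine_aut1 : affine_aut \1%VF.
Proof. by split=> [|b|x y]; rewrite ?id_lfunE. Qed.

Lemma Phi_f_refl_invol f s y :
  [set srefl Af b | b in Phi_ Phi0 f] s -> s (s y) = y.
Proof. by move=> [b /Phi_f_sub Pb <-]; apply: refl_invol. Qed.

Lemma generated_summand f X' g y : orth_summand (Phi_ Phi0 f) X' ->
  generated [set srefl Af b | b in Phi_ Phi0 f] g -> Phi_ Phi0 f y ->
  Phi_ Phi0 f (g y) /\ (X' (g y) <-> X' y).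
Proof.
move=> oX Gg; move: y.
elim/(generated_ind (@Phi_f_refl_invol f)): g / Gg => [y Py|_ h [b Pb <-] IH y Py].
  by rewrite id_lfunE.
have [Phy [h1 h2]] := IH y Py; rewrite comp_lfunE.
have Psh := rc_refl (Phi_f_refl_closed f) Pb Phy.
split=> //; split=> [X's|X'y]; last by apply: (summand_srefl oX) => //; apply: h2.
apply: h1; rewrite -[h y](refl_invol _ (Phi_f_sub Pb)).
exact: (summand_srefl oX).
Qed.

Lemma half_decompose P (f : dualV V0) : halfset (Phi Phi0) P ->
  (forall a, Phi0 a -> (0 <= (f a : R) <-> exists k : int, P (a, k%:~R))) ->
  exists X' g, [/\ orth_summand (Phi_ Phi0 f) X',
    generated [set srefl Af b | b in Phi_ Phi0 f] g
    & forall x, Phi Phi0 x -> (P x <-> triple_half f X' g x)].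
Proof.
move=> hP fP; have [PN Pc] := hP.
have oppP a (k : int) : Phi0 a -> ~ P (a, k%:~R) -> P (- a, (- k)%:~R).
  by move=> Pa nP; rewrite affN; apply/PN => //; apply: PhiI.
have negPN a (k : int) : Phi0 a -> P (- a, k%:~R) -> ~ P (a, (- k)%:~R).
  move=> Pa Pk; apply/PN; first exact: PhiI.
  by rewrite -affN opprK.
have conv a (k m l : int) : Phi0 a -> P (a, k%:~R) -> P (a, l%:~R) ->
    k < m -> m < l -> P (a, m%:~R).
  move=> Pa Pk Pl km ml.
  have kmR : (k%:~R : R) < m%:~R by rewrite ltr_int.
  have mlR : (m%:~R : R) < l%:~R by rewrite ltr_int.
  pose d : R := l%:~R - k%:~R; have d0 : 0 < d by rewrite /d; lra.
  apply: (Pc (a, k%:~R) (a, l%:~R) _ ((l%:~R - m%:~R) / d) ((m%:~R - k%:~R) / d)) => //;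
    try exact: PhiI; try by rewrite divr_gt0 // subr_gt0.
  apply: (scalerI (lt0r_neq0 d0)).
  rewrite scalerDr !scalerA ![d * _]mulrC !divfK ?lt0r_neq0 //; congr (_, _) => /=.
    by rewrite -scalerDl; congr (_ *: _); rewrite /d; ring.
  rewrite -![_ *: _]/(_ * _) /d; ring.
have fN a : (f (- a) : R) = - f a by rewrite functionalN.
have exP a : Phi0 a -> (f a : R) = 0 -> exists k : int, P (a, k%:~R).
  by move=> Pa fa; apply/fP; rewrite ?fa.
have exnP a : Phi0 a -> (f a : R) = 0 -> exists k : int, ~ P (a, k%:~R).
  move=> Pa fa; have [||k Pk] := exP (- a); [exact: rootN | by rewrite fN fa oppr0 |].
  by exists (- k); apply: negPN.
pose up a := exists C : int, forall k, C <= k -> P (a, k%:~R).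
pose dn a := exists C : int, forall k, k <= C -> P (a, k%:~R).
(* The levels missing from [P] form a convex set, since they are the negatives of the levels of
   [- a]. A level [k1] in [P] thus brings with it all levels beyond it, on the side away from the
   missing level [k2]. *)
have updn a : Phi0 a -> (f a : R) = 0 -> up a \/ dn a.
  move=> Pa fa; have [k1 Pk1] := exP a Pa fa; have [k2 nPk2] := exnP a Pa fa.
  have [k12|k21|k12] := ltgtP k1 k2; last by exfalso; apply: nPk2; rewrite -k12.
  - right; exists k1 => k kk; apply: contrapT => nPk.
    have ne : k <> k1 by move=> kE; apply: nPk; rewrite kE.
    have kk1 : k < k1 by rewrite lt_neqAle kk andbT; apply/eqP.
    apply: (negPN a (- k1) Pa); last by rewrite opprK.
    apply: (conv _ (- k2) _ (- k)); rewrite ?ltrN2 //; first exact: rootN.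
      exact: oppP.
    exact: oppP.
  - left; exists k1 => k kk; apply: contrapT => nPk.
    have ne : k <> k1 by move=> kE; apply: nPk; rewrite kE.
    have kk1 : k1 < k by rewrite lt_neqAle kk andbT eq_sym; apply/eqP.
    apply: (negPN a (- k1) Pa); last by rewrite opprK.
    apply: (conv _ (- k) _ (- k2)); rewrite ?ltrN2 //; first exact: rootN.
      exact: oppP.
    exact: oppP.
have upN a : Phi0 a -> (f a : R) = 0 -> up a -> up (- a).
  move=> Pa fa [C hC]; have [k2 nPk2] := exnP a Pa fa.
  exists (- k2) => k kk; rewrite -[k]opprK; apply: oppP => // Pk.
  have k2k : k2 <> - k by move=> kE; apply: nPk2; rewrite kE.
  apply: nPk2; apply: (conv a (- k) k2 (`|C| + `|k2| + 1)%R) => //; try lia.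
  by apply: hC; lia.
(* Adding high translates of [a] to low translates of [b] would reach [s_a b = b - m a] at every
   level [j], but a root with [f = 0] misses some level. *)
have orth a b : Phi0 a -> Phi0 b -> (f a : R) = 0 -> (f b : R) = 0 -> up a -> dn b ->
    form b a < 0 -> False.
  move=> Pa Pb fa fb [C hC] [C' hC'] ba.
  have /intrP[m mE] := root_int hPhi0 Pa Pb.
  have m0 : m < 0.
    by rewrite -(ltrz0 R) -mE pmulr_llt0 ?invr_gt0 ?root_gt0 // pmulr_rlt0.
  have sE : refl0 form a b = b - m%:~R *: a by rewrite (sreflE form_semidot) mE.
  have Psb := root_refl hPhi0 Pa Pb.
  have all j : P (refl0 form a b, j%:~R).
    pose k := `|C| + `|C'| + `|j|.
    apply: (Pc (a, k%:~R) (b, (j + m * k)%:~R) _ (- m)%:~R 1) => //; try exact: PhiI.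
    - by apply: hC; rewrite /k; lia.
    - by apply: hC'; rewrite /k; nia.
    - by rewrite ltr0z oppr_gt0.
    rewrite scale1r sE; congr (_, _) => /=; first by rewrite rmorphN scaleNr addrC.
    by rewrite -[_ *: _]/(_ * _) -rmorphM -rmorphD; congr _%:~R; ring.
  have fsb : (f (refl0 form a b) : R) = 0.
    by rewrite sE -scaleNr functionalD functionalZ fa fb mulr0 addr0.
  by have [k] := exnP _ Psb fsb; apply; apply: all.
pose X' : set (affV V0) := [set x | Phi_ Phi0 f x /\ up x.1].
have oX : orth_summand (Phi_ Phi0 f) X'.
  split=> [x []//|x y [/Phi_fE[[a [k [Pa ->]]] fa] ua] [/Phi_fE[[b [l [Pb ->]]] fb] nX]].
  rewrite /= in fa fb ua nX; have db : dn b.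
    case: (updn b Pb fb) => // ub; exfalso; apply: nX; split=> //.
    by apply/Phi_fE; split; first exact: PhiI.
  rewrite /affform /= (sdotC form_semidot); apply/eqP; rewrite eq_le.
  apply/andP; split; rewrite leNgt; apply/negP => h.
    apply: (orth (- a) b) => //; [exact: rootN | by rewrite fN fa oppr0 | exact: upN |].
    by rewrite (sdotNr form_semidot) oppr_lt0.
  exact: (orth a b).
have hQ0 := summand_half oX affine_aut1.
have hP' := halfset_sub (@Phi_f_sub f) hP.
have [|g Gg gE] := half_transitive affform_semidot (Phi_f_refl_closed f) hQ0 hP'.
  (* For [up a] the wrong levels are below [C] at positive roots; otherwise they are above [C] at
     negative roots. [ell_bound] bounds them on the other side. *)
  apply: finite_affine => [x [[]]//|a Pa].
  have [D hD] := ell_bound a.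
  have [fa|fa] := pselect ((f a : R) = 0); last by exists 0%N => k [/Phi_fE[_]].
  have Pfa k : Phi_ Phi0 f (a, k%:~R) by apply/Phi_fE; split; first exact: PhiI.
  have [[C hC]|nu] := pselect (up a).
    exists (D + `|C|)%N => k [_ /= Q0 nPk]; move: Q0; rewrite id_lfunE => -[/(_ _) e0 _].
    have e0' : 0 < ell (a, k%:~R) by apply: e0; split=> //; exists C.
    have := (hD k).1 e0'; have : k < C by rewrite ltNge; apply/negP => /hC.
    lia.
  have [//|[C hC]] := updn a Pa fa.
  exists (D + `|C|)%N => k [_ /= Q0 nPk]; move: Q0; rewrite id_lfunE => -[_ e0].
  have e0' : ~ 0 < ell (a, k%:~R) by move=> /e0[].
  have := (hD k).2 e0'; have : C < k by rewrite ltNge; apply/negP => /hC.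
  lia.
exists X', g; split=> // x Px.
have [a [k [Pa xE]]] := Px.
rewrite /triple_half /= xE /=.
have [fa|fa|fa] := ltgtP (f a : R) 0.
- split=> [Pk|[|[]]] //; last by move=> fa0; move: fa; rewrite fa0 ltxx.
  by move: fa; rewrite ltNge => /negP[]; apply/fP => //; exists k.
- split=> [|_]; first by left.
  apply: contrapT => /(oppP _ _ Pa) nPk.
  have : 0 <= (f (- a) : R) by apply/fP; [exact: rootN | exists (- k)].
  by rewrite fN oppr_ge0 leNgt fa.
have Pfx : Phi_ Phi0 f x by apply/Phi_fE; rewrite xE; split; first exact: PhiI.
have [_ gXx] := generated_summand oX Gg Pfx.
have := gE x Pfx; rewrite /= id_lfunE -xE => ->.
split=> [[h1 h2]|[//|[_ [h1 h2]]]].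
  by right; split=> //; split=> [/gXx|/h2/gXx]; first exact: h1.
by split=> [/gXx/h1|/h2 /gXx].
Qed.

(** * Stabilizers of faces and recovery of the triple *)

Lemma sign_cone_eqP f f' : sign_cone f = sign_cone f' <->
  forall a, Phi0 a -> (0 <= (f a : R) <-> 0 <= (f' a : R)).
Proof.
split=> [ff' a Pa|ff'].
  have : sign_cone f' f by rewrite -ff'.
  have : sign_cone f f' by rewrite ff'.
  by move=> h1 h2; split; [apply: h1 | apply: h2].
apply/seteqP; split=> k kf a Pa fa; apply: kf => //; exact/(ff' a Pa).
Qed.

(** If [s_b] preserves the cone, it sends [f] to a member with value [- f b.1] at [b], which must
    respect the sign of [f b.1]. Conversely, if [f b.1 = 0], the whole cone vanishes at [b] and is
    fixed pointwise. *)
Lemma stab_refl f b : Phi Phi0 b ->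
  (stab form simple theta (sign_cone f) (refl form b) <-> (f b.1 : R) = 0).
Proof.
move=> Pb; have Pb1 : Phi0 b.1 by case: Pb => a [k [Pa ->]].
have inv : (refl form b)^-1%VF = refl form b.
  by apply: inv_lfun_eq => x; apply: refl_invol.
split=> [[_ sE]|fb]; last first.
  split; first exact: W_refl.
  have fixF h : sign_cone f h -> (ext h \o (refl form b)^-1)%VF = ext h.
    move=> hf; have hb : (h b.1 : R) = 0.
      apply/eqP; rewrite eq_le hf ?fb // andbT -oppr_ge0 -functionalN.
      by apply: hf; [exact: rootN | rewrite functionalN fb oppr0].
    apply/lfunP => x; rewrite comp_lfunE inv !extE reflE /=.
    rewrite linearB linearZ /= hb scaler0 subr0 //.
  apply/seteqP; split=> [_ [_ [h hf <-] <-]|_ [h hf <-]].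
    by exists h => //; rewrite fixF.
  by exists (ext h); [exists h | exact: fixF].
have [h hf hE] : [set ext h | h in sign_cone f] (ext f \o (refl form b)^-1)%VF.
  by rewrite -sE; exists (ext f) => //; exists f.
have hb : (h b.1 : R) = - f b.1.
  have /(congr1 (fun u : 'Hom(affV V0, R^o) => (u b : R))) := hE.
  rewrite comp_lfunE inv !extE => ->.
  rewrite -[refl form b]/(srefl Af b) (srefl_id affform_semidot) ?functionalN //.
  exact: (rc_gt0 Phi_refl_closed).
have [fb|fb|//] := ltgtP (f b.1 : R) 0.
  have : 0 <= (h (- b.1) : R).
    by apply: hf; [exact: rootN | rewrite functionalN oppr_ge0 ltW].
  by rewrite functionalN hb opprK leNgt fb.
have : 0 <= (h b.1 : R) by apply: hf => //; exact: ltW.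
by rewrite hb oppr_ge0 leNgt fb.
Qed.

Lemma W_E f : W_ form Phi0 simple theta (sign_cone f) =
  generated [set srefl Af b | b in Phi_ Phi0 f].
Proof.
congr generated; apply/seteqP; split=> [t [st [b Pb tE]]|_ [b /Phi_fE[Pb fb] <-]].
  rewrite tE in st *; exists b => //; apply/Phi_fE; split=> //.
  exact/(stab_refl f Pb).
by split; [apply/(stab_refl f Pb) | exists b].
Qed.

Lemma W_sub F g : W_ form Phi0 simple theta F g -> W form simple theta g.
Proof. by apply: generated_sub => t [[]]. Qed.

(** Translates of one root along [delta] have product [form a a], so they are never orthogonal;
    level 0 can represent all levels. *)
Lemma summand_shift f X' a (k l : int) : orth_summand (Phi_ Phi0 f) X' ->
  X' (a, k%:~R) -> X' (a, l%:~R).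
Proof.
move=> oX X'a; have /Phi_fE[[a' [k' [Pa [aE _]]]] fa] := oX.1 _ X'a.
rewrite -aE in Pa; apply: (summand_nonorth oX) X'a.
- by apply/Phi_fE; split; first exact: PhiI.
- by apply/Phi_fE; split; first exact: PhiI.
- by rewrite /affform /= => a0; have := root_gt0 Pa; rewrite a0 ltxx.
Qed.

Lemma summand_opp f X' a (k l : int) : orth_summand (Phi_ Phi0 f) X' ->
  X' (a, k%:~R) -> X' (- a, l%:~R).
Proof.
move=> oX X'a; apply: (summand_shift (k := - k) _ oX); rewrite affN.
by apply: (summandN oX) => //; apply: oX.1.
Qed.

Definition asym_set (f : dualV V0) (X' : set (affV V0)) : set V0 :=
  [set a | 0 < (f a : R) \/ X' (a, 0)].

Lemma Bset_asym f X' w a : orth_summand (Phi_ Phi0 f) X' -> W form simple theta w ->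
  Phi0 a -> exists C : nat, forall k : int, C%:Z < k ->
    (Bset Phi0 simple f X' w (a, k%:~R) <-> asym_set f X' a).
Proof.
move=> oX Ww Pa; have [aw _ _] := W_affine_aut Ww; have [_ wP _] := aw.
have [C hC] := sign_change_bound a aw; exists C => k Ck.
have pk : pos (Phi Phi0) ell (a, k%:~R).
  by split; [exact: PhiI | apply: ell_ge1 => //; lia].
have wpos : 0 < ell ((w^-1)%VF (a, k%:~R)).
  have := hf_neq0 Phi_height (wP _ pk.1); rewrite neq_lt => /orP[/(hC _ pk.2)|//].
  lia.
rewrite (BsetE oX _ Ww) /triple_half /asym_set /= wpos.
split=> [[_ [|[_ [_ /(_ isT) X'k]]]]|[fa|X'a]].
- by left.
- by right; apply: (summand_shift (k := k) 0 oX).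
- by split=> //; left.
split=> //; right; split; first by have /Phi_fE[] := oX.1 _ X'a.
by split=> // _; apply: (summand_shift (k := 0) k oX).
Qed.

Lemma finite_setY_eq f1 X1 w1 f2 X2 w2 :
  orth_summand (Phi_ Phi0 f1) X1 -> W form simple theta w1 ->
  orth_summand (Phi_ Phi0 f2) X2 -> W form simple theta w2 ->
  finite_set (Bset Phi0 simple f1 X1 w1 `+` Bset Phi0 simple f2 X2 w2) ->
  sign_cone f1 = sign_cone f2 /\ X1 = X2.
Proof.
move=> o1 W1 o2 W2 /finite_affine_bound[C hC].
have asymE a : Phi0 a -> (asym_set f1 X1 a <-> asym_set f2 X2 a).
  move=> Pa; have [C1 h1] := Bset_asym o1 W1 Pa; have [C2 h2] := Bset_asym o2 W2 Pa.
  pose k : int := (C + C1 + C2).+1%:Z.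
  rewrite -(h1 k) -?(h2 k) /k; [|lia..].
  have nY : ~ (Bset Phi0 simple f1 X1 w1 `+` Bset Phi0 simple f2 X2 w2) (a, k%:~R).
    by move=> /hC; rewrite /k; lia.
  split=> B; apply: contrapT => nB; apply: nY; [by left | by right].
(* Where [f a = 0], [asym_set] contains both or neither of [a] and [- a]; so it contains [- a] alone
   exactly when [f a < 0]. *)
have sgn f X' a : orth_summand (Phi_ Phi0 f) X' -> Phi0 a ->
    (0 <= (f a : R) <-> ~ (asym_set f X' (- a) /\ ~ asym_set f X' a)).
  move=> oX Pa; rewrite /asym_set /= functionalN oppr_gt0; split.
    move=> fa [[neg|X'n] na]; first by have := lt_le_trans neg fa; rewrite ltxx.
    by apply: na; right; rewrite -[a]opprK; apply: (summand_opp (k := 0) 0 oX).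
  move=> h; rewrite leNgt; apply/negP => fa; apply: h; split; first by left.
  case=> [fa'|X'a]; first by have := lt_trans fa fa'; rewrite ltxx.
  by have /Phi_fE[_ /= f0] := oX.1 _ X'a; move: fa; rewrite f0 ltxx.
have sE : sign_cone f1 = sign_cone f2.
  apply/sign_cone_eqP => a Pa; rewrite (sgn _ X1) // (sgn _ X2) //.
  by rewrite !asymE //; apply: rootN.
split=> //.
have sub f X' g Y : orth_summand (Phi_ Phi0 f) X' -> orth_summand (Phi_ Phi0 g) Y ->
    sign_cone f = sign_cone g ->
    (forall a, Phi0 a -> asym_set f X' a -> asym_set g Y a) -> X' `<=` Y.
  move=> oX oY /sign_cone_eqP fg h x X'x.
  have /Phi_fE[[a [k [Pa xE]]] fa] := oX.1 _ X'x; rewrite xE /= in X'x fa *.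
  have ga : (g a : R) <= 0.
    rewrite -oppr_ge0 -functionalN; apply/(fg _ (rootN Pa)).
    by rewrite functionalN fa oppr0.
  have : asym_set g Y a.
    by apply: h => //; right; apply: (summand_shift (k := k) 0 oX).
  case=> [ga'|Ya]; first by have := lt_le_trans ga' ga; rewrite ltxx.
  exact: (summand_shift (k := 0) k oY).
apply/seteqP; split; [apply: (sub f1 _ f2) | apply: (sub f2 _ f1)] => // a Pa; by apply asymE.
Qed.

Lemma Bset_biclosed f X' w : orth_summand (Phi_ Phi0 f) X' -> W form simple theta w ->
  biclosed Phi0 simple (Bset Phi0 simple f X' w).
Proof.
move=> oX Ww; have [aw _ _] := W_affine_aut Ww.
rewrite (_ : Bset _ _ _ _ _ = triple_half f X' (w^-1)%VF `&` pos (Phi Phi0) ell).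
  by apply: half_biclosed; apply: triple_halfP.
by apply/seteqP; split=> x; [move=> /(BsetE oX _ Ww)[]|move=> [? ?]; apply/(BsetE oX _ Ww)].
Qed.

(** Both inverses give the same signs on [Phi_F], so [w2^-1 w1] keeps its positive roots positive
    and [simple_free] applies. *)
Lemma Bset_inj f X' w1 w2 : orth_summand (Phi_ Phi0 f) X' ->
  generated [set srefl Af b | b in Phi_ Phi0 f] w1 ->
  generated [set srefl Af b | b in Phi_ Phi0 f] w2 ->
  Bset Phi0 simple f X' w1 = Bset Phi0 simple f X' w2 -> w1 = w2.
Proof.
move=> oX; rewrite -W_E => G1 G2 BE.
have [W1 W2] := (W_sub G1, W_sub G2); rewrite W_E in G1 G2.
have [[_ w1P _] w1K _] := W_affine_aut W1; have [[_ w2P _] _ w2VK] := W_affine_aut W2.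
have ne g x : (forall b, Phi Phi0 b -> Phi Phi0 (g b)) -> Phi_ Phi0 f x -> ell (g x) != 0.
  by move=> gP /Phi_f_sub/gP; apply: (hf_neq0 Phi_height).
have sg (r : R) : r != 0 -> (0 < r <-> ~ r < 0).
  by rewrite neq_lt => /orP[h|h]; rewrite h ltNge (ltW h); split.
have posE x : pos (Phi_ Phi0 f) ell x ->
    (0 < ell ((w1^-1)%VF x) <-> 0 < ell ((w2^-1)%VF x)).
  move=> [Px ex]; have px : pos (Phi Phi0) ell x by split=> //; apply: Phi_f_sub Px.
  have /Phi_fE[_ fx] := Px.
  have th w : triple_half f X' w x <-> (X' x <-> 0 < ell (w x)).
    by rewrite /triple_half /= fx ltxx; split=> [[//|[]//]|h]; right.
  have := BsetE oX x W1; rewrite BE (BsetE oX x W2) !th.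
  have [?|?] := pselect (X' x); have [?|?] := pselect (0 < ell ((w1^-1)%VF x));
    have [?|?] := pselect (0 < ell ((w2^-1)%VF x)); tauto.
have allE x : Phi_ Phi0 f x -> (0 < ell ((w1^-1)%VF x) <-> 0 < ell ((w2^-1)%VF x)).
  move=> Px; have := hf_neq0 Phi_height (Phi_f_sub Px); rewrite neq_lt => /orP[ex|ex].
    have PNx := refl_closedN affform_semidot (Phi_f_refl_closed f) Px.
    have /posE : pos (Phi_ Phi0 f) ell (- x) by split=> //; rewrite ellN oppr_gt0.
    rewrite !linearN !ellN !oppr_gt0.
    by rewrite (sg _ (ne _ _ w1P Px)) (sg _ (ne _ _ w2P Px)); tauto.
  by apply: posE.
have g1 : (w2^-1 \o w1)%VF = \1%VF.
  apply: (simple_free affform_semidot (Phi_f_refl_closed f)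
    (height_sub (Phi_f_refl_closed f) (@Phi_f_sub f))).
    have [_ GM GV] := generated_subgroup [set srefl Af b | b in Phi_ Phi0 f].
    by apply: GM => //; apply: GV.
  move=> x [Px ex]; have [Pwx _] := generated_summand oX G1 Px.
  by rewrite comp_lfunE; apply/allE => //; rewrite w1K.
apply/lfunP => x; rewrite -[LHS]w2VK; congr (w2 _).
by have /lfunP/(_ x) := g1; rewrite comp_lfunE id_lfunE.
Qed.

End FiniteSystem.

Theorem theorem4p10 (R : realType) (V0 : vectType R) (form : {dot V0 for idfun})
  (n : nat) (Phi0 : set V0) (simple : n.-tuple V0) (theta : V0)
  (hPhi0 : is_root_system form Phi0) (hind : indecomposable form Phi0)
  (hsimple : is_simple_system Phi0 simple)
  (htheta : is_highest_root Phi0 simple theta)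
  (pt : set (dualV V0) -> dualV V0)
  (hpt : forall F, face form Phi0 simple F -> relint simple F (pt F)) :
  [/\ set_bij (triples form Phi0 simple pt (W_ form Phi0 simple theta))
        (biclosed Phi0 simple) (Btriple Phi0 simple pt),
      (forall p, triples form Phi0 simple pt (stab form simple theta) p ->
         biclosed Phi0 simple (Btriple Phi0 simple pt p))
    & forall F1 Phi1 w1 F2 Phi2 w2,
        triples form Phi0 simple pt (stab form simple theta) (F1, Phi1, w1) ->
        triples form Phi0 simple pt (stab form simple theta) (F2, Phi2, w2) ->
        (finite_set (Btriple Phi0 simple pt (F1, Phi1, w1)
                       `+` Btriple Phi0 simple pt (F2, Phi2, w2)) <->
         F1 = F2 /\ Phi1 = Phi2)].
Proof.
have coneE F : face form Phi0 simple F -> F = sign_cone Phi0 (pt F).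
  by move=> fF; apply: (relint_sign_cone hPhi0 hsimple fF); apply: hpt.
have oP F X' : union_of_components form (Phi_ Phi0 (pt F)) X' ->
    orth_summand form (Phi_ Phi0 (pt F)) X'.
  by move=> /union_of_componentsP.
have WstabF F w : stab form simple theta F w -> W form simple theta w by case.
have WE F : face form Phi0 simple F -> W_ form Phi0 simple theta F =
    generated [set srefl (affform form) b | b in Phi_ Phi0 (pt F)].
  by move=> fF; rewrite {1}(coneE _ fF) (W_E hPhi0 hsimple htheta).
split=> [|[[F X'] w] [/= fF /oP oX /WstabF Ww]|]; last 1 first.
- move=> F1 X1 w1 F2 X2 w2 [/= fF1 /oP oX1 /WstabF W1] [/= fF2 /oP oX2 /WstabF W2].
  rewrite /Btriple /=; split=> [fin|[FE XE]].
    have [cE XE] := finite_setY_eq hPhi0 hsimple htheta oX1 W1 oX2 W2 fin.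
    by split=> //; rewrite (coneE _ fF1) (coneE _ fF2) cE.
  (* With the same [A] and [Z], the two sets can differ only on the inversion sets of [w1] and
     [w2]. *)
  rewrite -FE -XE /Bset; set A := _ `|` _; set Z := Phi_ _ _.
  apply: (@sub_finite_set _ _ (N Phi0 simple w1 `|` N Phi0 simple w2)); last first.
    by rewrite finite_setU; split; apply: (N_finite hPhi0 hsimple htheta).
  move=> x; rewrite /setY /setD /setU /setI /=.
  have [?|?] := pselect (A x); have [?|?] := pselect (N Phi0 simple w1 x);
    have [?|?] := pselect (N Phi0 simple w2 x); tauto.
- split.
  + move=> [[F X'] w] [/= fF /oP oX Ww].
    by apply: (Bset_biclosed hPhi0 hsimple htheta) => //; apply: W_sub Ww.
  + move=> [[F1 X1] w1] [[F2 X2] w2] /set_mem[/= fF1 /oP oX1 W1] /set_mem[/= fF2 /oP oX2 W2].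
    rewrite /Btriple /= => BE.
    have [|cE XE] := finite_setY_eq hPhi0 hsimple htheta oX1 (W_sub W1) oX2 (W_sub W2).
      by rewrite BE setYK.
    have FE : F1 = F2 by rewrite (coneE _ fF1) (coneE _ fF2).
    rewrite -FE -XE WE // in W2 BE *; rewrite WE // in W1.
    by rewrite (Bset_inj hPhi0 hsimple htheta oX1 W1 W2 BE).
  move=> B bB; have hP := biclosed_half hPhi0 hsimple htheta bB.
  have [f fP] := parabolic_functional hPhi0 hP.
  pose F := sign_cone Phi0 f; have fF : face form Phi0 simple F.
    exact: (sign_cone_face hPhi0 hsimple).
  (* The triple must use the chosen point [pt F] instead of [f]; both have the same signs on roots,
     so [pt F] inherits the property of [f]. *)
  have ff' := (sign_cone_eqP Phi0 f (pt F)).1 (coneE _ fF).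
  have fP' a : Phi0 a -> (0 <= (pt F a : R) <->
      exists k : int, two_sided Phi0 simple theta B (a, k%:~R)).
    by move=> Pa; rewrite -ff' // fP.
  have [X' [g [oX Gg gP]]] := half_decompose hPhi0 hsimple htheta hP fP'.
  have [_ _ GV] := generated_subgroup [set srefl (affform form) b | b in Phi_ Phi0 (pt F)].
  have WgV : W_ form Phi0 simple theta F (g^-1)%VF by rewrite WE //; apply: GV.
  have [gK gVK] := generated_inv (Phi_f_refl_invol hPhi0 (f := pt F)) Gg.
  exists (F, X', g^-1)%VF; first by split=> //; apply/union_of_componentsP.
  rewrite /Btriple /=; apply/seteqP; split=> x.
    move=> /(BsetE hPhi0 hsimple htheta oX _ (W_sub WgV))[px].
    by rewrite (inv_lfun_eq gVK gK) => /(gP _ px.1)/(two_sidedE _ px).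
  move=> Bx; have px : pos (Phi Phi0) (ell simple theta) x.
    by apply/(Phi_posE hPhi0 hsimple htheta)/bB.1.
  apply/(BsetE hPhi0 hsimple htheta oX _ (W_sub WgV)); split=> //.
  by rewrite (inv_lfun_eq gVK gK); apply/(gP _ px.1)/(two_sidedE _ px).
- exact: (Bset_biclosed hPhi0 hsimple htheta).
Qed.
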